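(* Let $\mathsf G$ be a weighted graph with a well. Let $\mathsf F$ be a Euclidean or Hermitian vector bundle over $\mathsf G$, endowed with a connection $h$ and a potential $H$. Let $f\in\Omega^0(\mathsf V\setminus\mathsf W,\mathsf F)$. For all $x\in\mathsf V\setminus\mathsf W$ and all $t\ge0$, $$\left(e^{-t\Delta_{h,H}}f\right)(x)=\int_{\mathsf P(\mathsf G)}\mathrm{hol}_{h,H}\big((\gamma_{|[0,t)})^{-1}\big)f(\gamma_t)\,d\mathbb P_x(\gamma).$$
   Context: Graphs. A graph $\mathsf G$ consists of non-empty finite sets $\mathsf V$ (vertices) and $\mathsf E$ (oriented edges), maps $s,t:\mathsf E\to\mathsf V$ and a fixed-point free involution $i$ of $\mathsf E$ with $t\circ i=s$; write $\underline e=s(e)$, $\overline e=t(e)$, $e^{-1}=i(e)$ (multiple edges and loop edges are allowed). A weighted graph with a well is a connected graph with a non-empty proper subset $\mathsf W\subset \mathsf V$ (the well; elements of $\mathsf V\setminus\mathsf W$ are the proper vertices) and a function $\chi:\mathsf E\to(0,\infty)$ with $\chi_{e^{-1}}=\chi_e$. Set $\lambda_x=\sum_{e:\underline e=x}\chi_e$ and $P_{x,e}=\chi_e/\lambda_x$ when $\underline e=x$. Paths. A discrete path is $(x_0,e_1,x_1,\dots,e_n,x_n)$, $n\ge0$, with $\underline{e_k}=x_{k-1}$, $\overline{e_k}=x_k$. A continuous path is $\gamma=((x_0,\tau_0),e_1,(x_1,\tau_1),\dots,e_n,(x_n,\tau_n))$ with $(x_0,e_1,\dots,x_n)$ a discrete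 path, $\tau_0,\dots,\tau_{n-1}\in(0,\infty)$, $\tau_n\in(0,\infty]$. $\mathsf P(\mathsf G)$ is the set of continuous paths with its natural $\sigma$-field (countable union of products of finite sets and intervals). For $0\le t<|\gamma|=\sum_k\tau_k$, $\gamma_t=x_k$ if $\tau_0+\dots+\tau_{k-1}\le t<\tau_0+\dots+\tau_k$, and for $0<t<|\gamma|$, $\gamma_{|[0,t)}=((x_0,\tau_0),e_1,\dots,e_k,(x_k,t-(\tau_0+\dots+\tau_{k-1})))$. If $|\gamma|<\infty$, $\gamma^{-1}=((x_n,\tau_n),e_n^{-1},\dots,e_1^{-1},(x_0,\tau_0))$. Random walk. For $x\in\mathsf V$, $\mathbb P_x$ is the law on $\mathsf P(\mathsf G)$ of the path obtained as follows: start at $x_0=x$; from a proper vertex $x_k$ choose an edge $e_{k+1}$ issued from $x_k$ with probability $P_{x_k,e_{k+1}}$ and move to $\overline{e_{k+1}}$; stop at the first vertex in $\mathsf W$; holding times at the proper vertices visited are independent exponential variables of parameter $1$, and the last holding time (in the well) is $+\infty$. Bundles. Let $\mathbb K=\mathbb R$ or $\mathbb C$. A Euclidean (resp. Hermitian) vector bundle of rank $r$ is a collection of $r$-dimensional Euclidean (resp. Hermitian) spaces $\mathsf F_x$ ($x\in\mathsf V$), $\mathsf F_e=\mathsf F_{e^{-1}}$ ($e\in\mathsf E$) over $\mathbb K$. A connection $h$ consists, for every edge $e$, of orthogonal (resp. unitary) isomorphisms $h_{e,\underline e}:\mathsf F_{\underline e}\to\mathsf F_e$ and $h_{\overline e,e}:\mathsf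 F_e\to\mathsf F_{\overline e}$ with $h_{\underline e,e^{-1}}=h_{e,\underline e}^{-1}$; set $h_e=h_{\overline e,e}\circ h_{e,\underline e}:\mathsf F_{\underline e}\to\mathsf F_{\overline e}$. A potential $H$ is a family of symmetric (resp. Hermitian) operators $H_x\in\mathrm{End}(\mathsf F_x)$, $x\in\mathsf V$, with $H_x=0$ for $x\in\mathsf W$. The twisted holonomy along a continuous path $\gamma=((x_0,\tau_0),e_1,(x_1,\tau_1),\dots,e_n,(x_n,\tau_n))$ (with $\tau_n<\infty$ or $H_{x_n}=0$) is $\mathrm{hol}_{h,H}(\gamma)=e^{-\tau_nH_{x_n}}\circ h_{e_n}\circ\cdots\circ e^{-\tau_1H_{x_1}}\circ h_{e_1}\circ e^{-\tau_0H_{x_0}}:\mathsf F_{x_0}\to\mathsf F_{x_n}$; for $t=0$, $\mathrm{hol}_{h,H}((\gamma_{|[0,0)})^{-1})$ is the identity of $\mathsf F_{\gamma_0}$. Laplacian. $\Omega^0(\mathsf V\setminus\mathsf W,\mathsf F)$ is the space of sections $f=(f(x))_{x\in\mathsf V}$, $f(x)\in\mathsf F_x$, vanishing on $\mathsf W$. On it, $\Delta_{h,H}=\Delta_h+H$, where $(Hf)(x)=H_xf(x)$ and $(\Delta_hf)(x)=f(x)-\sum_{e:\underline e=x}P_{x,e}\mathbf 1_{\mathsf V\setminus\mathsf W}(\overline e)\,h_{e^{-1}}f(\overline e)$ for $x\in\mathsf V\setminus\mathsf W$. *)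

(* Defs.v *)
From HB Require Import structures.
From mathcomp Require Import all_boot all_order all_algebra.
From mathcomp Require Import sesquilinear complex.
From mathcomp Require Import all_classical all_reals all_analysis.
From mathcomp Require Import measurable_realfun.

Set Implicit Arguments.
Unset Strict Implicit.
Unset Printing Implicit Defensive.

Import Order.TTheory GRing.Theory Num.Theory.
Import numFieldNormedType.Exports.

Local Open Scope classical_set_scope.
Local Open Scope ring_scope.

(** * Graphs *)

Record graph := Graph {
  vert : finType;
  edge : finType;
  src : edge -> vert;
  tgt : edge -> vert;
  einv : edge -> edge;
  vert_gt0 : (0 < #|vert|)%N;
  edge_gt0 : (0 < #|edge|)%N;
  einvK : involutive einv;
  einv_neq : forall e, einv e != e;
  tgt_einv : forall e, tgt (einv e) = src e
}.

Definition adj (G : graph) : rel (vert G) :=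
  fun x y => [exists e, (src e == x) && (tgt e == y)].

Record wgraph (R : realType) := WGraph {
  wgraph_graph :> graph;
  wgraph_connected : forall x y : vert wgraph_graph, connect (@adj wgraph_graph) x y;
  well : {set vert wgraph_graph};
  well_neq0 : well != finset.set0;
  well_neqT : well != finset.setT;
  cond : edge wgraph_graph -> R;
  cond_gt0 : forall e, 0 < cond e;
  cond_einv : forall e, cond (einv e) = cond e
}.

Definition lam (R : realType) (G : wgraph R) (x : vert G) : R :=
  \sum_(e : edge G | src e == x) cond e.

Definition jump_prob (R : realType) (G : wgraph R) (x : vert G) (e : edge G) : R :=
  if src e == x then cond e / lam x else 0.

(** * Scalars: K is R or C *)

Inductive scalar_kind := RealScalars | ComplexScalars.

Definition scalar_field (k : scalar_kind) (R : realType) : numFieldType :=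
  match k with RealScalars => R | ComplexScalars => R[i] end.

Definition conjK k (R : realType) : {rmorphism scalar_field k R -> scalar_field k R} :=
  match k with RealScalars => idfun | ComplexScalars => Num.conj end.

Definition reK k (R : realType) : scalar_field k R -> R :=
  match k with RealScalars => id | ComplexScalars => @complex.Re R end.

Definition imK k (R : realType) : scalar_field k R -> R :=
  match k with RealScalars => fun=> 0 | ComplexScalars => @complex.Im R end.

(* a + i b; the imaginary part is ignored in the real case *)
Definition mkK k (R : realType) : R -> R -> scalar_field k R :=
  match k with RealScalars => fun a _ => a | ComplexScalars => fun a b => (a +i* b)%C end.

Definition ofR k (R : realType) (a : R) : scalar_field k R := mkK k a 0.

(** * Limits, exponentials and integrals in finite-dimensional spaces *)

(* In finite dimension, limits and integrals may be taken coordinate by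
   coordinate, and do not depend on the basis used. *)

Definition vcoord (K : fieldType) (U : vectType K) (i : 'I_(\dim {:U})) (v : U) : K :=
  coord (vbasis {:U}) i v.

Definition vlim (K : numFieldType) (U : vectType K) (u : nat -> U) : U :=
  \sum_(i < \dim {:U}) (lim ((fun n => vcoord i (u n)) @ \oo)) *: (vbasis {:U})`_i.

Definition expv (K : numFieldType) (U : vectType K) (A : 'End(U)) (v : U) : U :=
  vlim (fun n => \sum_(j < n) (j`!%:R)^-1 *: iter j A v).

(* The same series for an operator on a space of sections; its limit is taken
   at each point. *)
Definition exp_section (K : numFieldType) (I : Type) (F : I -> vectType K)
    (A : (forall i, F i) -> (forall i, F i)) (f : forall i, F i) (i : I) : F i :=
  vlim (fun n => \sum_(j < n) (j`!%:R)^-1 *: iter j A f i).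

Section VectorIntegral.
Context d (T : measurableType d) (R : realType) (k : scalar_kind).
Variables (mu : {measure set T -> \bar R}) (U : vectType (scalar_field k R)).

Definition Kintegrable (g : T -> scalar_field k R) : Prop :=
  mu.-integrable setT (fun w => (reK (g w))%:E) /\
  mu.-integrable setT (fun w => (imK (g w))%:E).

Definition Kintegral (g : T -> scalar_field k R) : scalar_field k R :=
  mkK k (\int[mu]_w reK (g w)) (\int[mu]_w imK (g w)).

Definition vintegrable (g : T -> U) : Prop :=
  forall i, Kintegrable (fun w => vcoord i (g w)).

Definition vintegral (g : T -> U) : U :=
  \sum_(i < \dim {:U}) Kintegral (fun w => vcoord i (g w)) *: (vbasis {:U})`_i.

End VectorIntegral.

(** * Bundles, connections, potentials *)

Record hspace (k : scalar_kind) (R : realType) (r : nat) := HSpace {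
  hcarrier :> vectType (scalar_field k R);
  hdot : {dot hcarrier for @conjK k R};
  hdim : \dim {: hcarrier} = r
}.

Definition hcast k (R : realType) r (A B : hspace k R r) (p : A = B) : A -> B :=
  match p in _ = C return A -> C with erefl => id end.

Record bundle (k : scalar_kind) (R : realType) (r : nat) (G : graph) := Bundle {
  fibre :> vert G -> hspace k R r;
  efibre : edge G -> hspace k R r;
  efibre_einv : forall e, efibre (einv e) = efibre e
}.

(* Identification of the fibres at two vertices which are provably, but maybe
   not definitionally, equal.  The value 0 for distinct vertices is a junk
   value. *)
Definition transp k (R : realType) r (G : graph) (F : bundle k R r G)
    (x y : vert G) (v : F x) : F y :=
  match x =P y with
  | ReflectT p => hcast (congr1 (fibre F) p) v
  | ReflectF _ => 0
  end.
Arguments transp {k R r G F x} y v.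

(* [conn_in e] is h_{e,src e} and [conn_out e] is h_{tgt e,e} *)
Record connection k (R : realType) r (G : graph) (F : bundle k R r G) := Connection {
  conn_in : forall e, 'Hom(F (src e), efibre F e);
  conn_out : forall e, 'Hom(efibre F e, F (tgt e));
  conn_in_isometry : forall e,
    isometry (hdot (efibre F e)) (hdot (F (src e))) (conn_in e);
  conn_out_isometry : forall e,
    isometry (hdot (F (tgt e))) (hdot (efibre F e)) (conn_out e);
  (* h_{e, src e} is the inverse of h_{src e, e^-1} *)
  conn_back := fun e (w : efibre F e) =>
    hcast (congr1 (fibre F) (tgt_einv e))
      (conn_out (einv e) (hcast (esym (efibre_einv F e)) w));
  conn_inK : forall e, cancel (conn_in e) (@conn_back e);
  conn_backK : forall e, cancel (@conn_back e) (conn_in e)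
}.

Definition conn_edge k (R : realType) r (G : graph) (F : bundle k R r G)
    (h : connection F) (e : edge G) (v : F (src e)) : F (tgt e) :=
  conn_out h e (conn_in h e v).

Record potential k (R : realType) r (G : wgraph R) (F : bundle k R r G) := Potential {
  pot :> forall x, 'End(F x);
  pot_hermitian : forall x (u v : F x),
    hdot (F x) (pot x u) v = hdot (F x) u (pot x v);
  pot_well : forall x, x \in well G -> pot x = 0
}.

(** * The Laplacian on sections vanishing on the well *)

Section Laplacian.
Context (k : scalar_kind) (R : realType) (r : nat) (G : wgraph R) (F : bundle k R r G).
Variables (h : connection F) (H : potential F).

Definition section := forall x, F x.

Definition section0 (f : section) : Prop := forall x, x \in well G -> f x = 0.

Definition lap_conn (f : section) : section := fun x =>
  if x \in well G then 0 else
  f x - \sum_(e : edge G | (src e == x) && (tgt e \notin well G))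
          ofR k (jump_prob x e) *:
            transp x (conn_edge h (transp (src (einv e)) (f (tgt e)))).

Definition lap (f : section) : section := fun x => lap_conn f x + H x (f x).

Definition heat (t : R) (f : section) : section :=
  exp_section (fun g x => ofR k (- t) *: lap g x) f.

End Laplacian.

(** * Paths *)

(* ((x0, [:: (tau_0, e_1); ...; (tau_(n-1), e_n)]), tau_n) stands for
   ((x_0, tau_0), e_1, ..., e_n, (x_n, tau_n)), where x_i is the target of e_i.
   Nothing is imposed here on the edges and on the holding times: truncating a
   path at a jump time yields a last holding time equal to 0. *)
Definition rawpath (R : realType) (G : graph) : Type :=
  ((vert G * seq (R * edge G)) * \bar R)%type.

Section RawPaths.
Context (R : realType) (G : graph).
Implicit Type g : rawpath R G.

Definition origin g : vert G := g.1.1.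
Definition steps g : seq (R * edge G) := g.1.2.
Definition last_time g : \bar R := g.2.
Definition times g : seq R := [seq s.1 | s <- steps g].
Definition edges g : seq (edge G) := [seq s.2 | s <- steps g].

Fixpoint walk (x : vert G) (es : seq (edge G)) : bool :=
  if es is e :: es' then (src e == x) && walk (tgt e) es' else true.

(* x_i, for i at most the number of edges *)
Definition nth_vert g (i : nat) : vert G := last (origin g) [seq tgt e | e <- take i (edges g)].
Definition endpoint g : vert G := last (origin g) [seq tgt e | e <- edges g].

(* tau_0 + ... + tau_(i-1) *)
Definition jump_time g (i : nat) : R := \sum_(0 <= j < i) (times g)`_j.

(* The least i < n such that t < tau_0 + ... + tau_i, or n if there is none; in
   the latter case it is the index of the vertex visited at time t only if t is
   less than the duration of the path. *)
Definition index_at g (t : R) : nat :=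
  find (fun i => t < jump_time g i.+1) (iota 0 (size (steps g))).

Definition position g (t : R) : vert G := nth_vert g (index_at g t).

Definition truncate g (t : R) : rawpath R G :=
  let i := index_at g t in
  ((origin g, take i (steps g)), (t - jump_time g i)%:E).

(* [zip] drops tau_0, which is the last holding time of the reversed path *)
Definition reverse g : rawpath R G :=
  let ts := rcons (times g) (fine (last_time g)) in
  ((endpoint g, zip (rev ts) (rev [seq einv e | e <- edges g])), (head 0 ts)%:E).

Definition is_cpath g : bool :=
  [&& walk (origin g) (edges g), all (fun s => 0 < s) (times g) & (0 < last_time g)%E].

End RawPaths.

Section Holonomy.
Context (k : scalar_kind) (R : realType) (r : nat) (G : wgraph R) (F : bundle k R r G).
Variables (h : connection F) (H : potential F).

(* e^(- tau H_x); an infinite time is only meaningful where H_x = 0 *)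
Definition damp (x : vert G) (tau : \bar R) (v : F x) : F x :=
  if tau is s%:E then expv (ofR k (- s) *: H x) v else v.

Fixpoint hol_from (x : vert G) (s : seq (R * edge G)) (tau : \bar R) :
    F x -> F (last x [seq tgt e | e <- [seq p.2 | p <- s]]) :=
  match s with
  | [::] => fun v => damp tau v
  | p :: s' => fun v =>
      @hol_from (tgt p.2) s' tau
        (conn_edge h (transp (src p.2) (damp p.1%:E v)))
  end.

Definition hol (g : rawpath R G) : F (origin g) -> F (endpoint g) :=
  @hol_from (origin g) (steps g) (last_time g).

End Holonomy.
Arguments hol {k R r G F} h H g v.

(** * The measurable space of continuous paths *)

Definition vert0 (G : graph) : vert G := enum_val (Ordinal (vert_gt0 G)).

Record cpath (R : realType) (G : graph) := CPath {
  cpath_val :> rawpath R G;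
  cpathP : is_cpath cpath_val
}.

HB.instance Definition _ (R : realType) (G : graph) := [isSub for @cpath_val R G].
HB.instance Definition _ (R : realType) (G : graph) := [Choice of cpath R G by <:].

Definition cpath0 (R : realType) (G : graph) : cpath R G :=
  @CPath R G ((vert0 G, [::]), +oo%E) lt0y.

HB.instance Definition _ (R : realType) (G : graph) :=
  isPointed.Build (cpath R G) (cpath0 R G).

Section CPathMeasurable.
Context (R : realType) (G : graph).
Implicit Types (A : set (cpath R G)) (x : vert G).

Definition mkraw x n (es : n.-tuple (edge G)) (tau : n.-tuple R * \bar R) : rawpath R G :=
  ((x, zip tau.1 es), tau.2).

(* The holding times of the paths of A supported by a given discrete path. *)
Definition slice x n (es : n.-tuple (edge G)) A : set (n.-tuple R * \bar R) :=
  [set tau | exists2 g, A g & cpath_val g = mkraw x es tau].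

Definition cpath_measurable : set (set (cpath R G)) :=
  [set A | forall x n (es : n.-tuple (edge G)), measurable (slice x es A)].

Lemma slice0 x n (es : n.-tuple (edge G)) : slice x es set0 = set0.
Proof. by rewrite -subset0 => tau []. Qed.

Lemma slice_bigcup x n (es : n.-tuple (edge G)) (A : nat -> set (cpath R G)) :
  slice x es (\bigcup_i A i) = \bigcup_i slice x es (A i).
Proof.
apply/seteqP; split => tau.
  by move=> [g [i _ Aig] gE]; exists i => //; exists g.
by move=> [i _ [g Aig gE]]; exists g => //; exists i.
Qed.

Lemma sliceC x n (es : n.-tuple (edge G)) A :
  slice x es (~` A) = slice x es setT `\` slice x es A.
Proof.
apply/seteqP; split => tau.
  move=> [g nAg gE]; split; first by exists g.
  by move=> [g' Ag' g'E]; apply: nAg; rewrite (_ : g = g')//; apply: val_inj => /=; rewrite gE.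
move=> [[g _ gE] nA]; exists g => // Ag; apply: nA; by exists g.
Qed.

Lemma measurable_sliceT x n (es : n.-tuple (edge G)) : measurable (slice x es setT).
Proof.
case wes : (walk x es); last first.
  rewrite (_ : slice _ _ _ = set0) //; apply/seteqP; split => // tau [g _ gE] /=.
  have := cpathP g; rewrite /is_cpath gE /edges /steps /origin /= -/unzip2.
  by rewrite unzip2_zip ?size_tuple// wes.
have -> : slice x es setT =
    (\bigcap_(i in [set: 'I_n]) ((@tnth n R)^~ i @^-1` `]0, +oo[)) `*` `]0%E, +oo%E].
  apply/seteqP; split => -[tau tn] /=.
    move=> [g _ gE]; have := cpathP g.
    rewrite /is_cpath gE /edges /times /steps /origin /= -/unzip1.
    rewrite unzip1_zip ?size_tuple// => /and3P[_ /all_tnthP tau0 tn0]; split.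
      by move=> i _ /=; rewrite in_itv/= andbT.
    by rewrite in_itv/= tn0 leey.
  move=> [tau0]; rewrite in_itv/= => /andP[tn0 _].
  suff okg : is_cpath (mkraw x es (tau, tn)) by exists (CPath okg).
  rewrite /is_cpath /edges /times /steps /origin /= -/unzip1 -/unzip2.
  rewrite unzip1_zip ?unzip2_zip ?size_tuple// wes tn0 andbT /=.
  by apply/all_tnthP => i; have := tau0 i I; rewrite /= in_itv/= andbT.
apply: measurableX; last exact: emeasurable_itv.
apply: fin_bigcap_measurable => // i _.
by rewrite -[X in measurable X]setTI; exact: (@measurable_tnth _ R n i).
Qed.

Lemma cpath_measurable0 : cpath_measurable set0.
Proof. by move=> x n es; rewrite slice0. Qed.

Lemma cpath_measurableC A : cpath_measurable A -> cpath_measurable (~` A).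
Proof.
move=> mA x n es; rewrite sliceC.
by apply: measurableD; [exact: measurable_sliceT|exact: mA].
Qed.

Lemma cpath_measurable_bigcup (A : nat -> set (cpath R G)) :
  (forall i, cpath_measurable (A i)) -> cpath_measurable (\bigcup_i A i).
Proof.
move=> mA x n es; rewrite slice_bigcup; apply: bigcupT_measurable => i.
exact: mA.
Qed.

HB.instance Definition _ := isMeasurable.Build default_measure_display (cpath R G)
  cpath_measurable0 cpath_measurableC cpath_measurable_bigcup.

End CPathMeasurable.

(** * The law of the random walk stopped in the well *)

Section HoldingTimes.
Context (R : realType).

Definition exp1 : set (measurableTypeR R) -> \bar R := exponential_prob 1.

HB.instance Definition _ := Probability.copy exp1
  (@exponential_distribution_exponential_prob__canonical__probability_measure_Probability
    R 1 ltr01).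

Definition cons_times n (p : measurableTypeR R * n.-tuple R) : n.+1.-tuple R := cons_tuple p.1 p.2.

Lemma measurable_cons_times n : measurable_fun setT (@cons_times n).
Proof. exact: measurable_cons. Qed.

HB.instance Definition _ n :=
  isMeasurableFun.Build _ _ _ _ (@cons_times n) (@measurable_cons_times n).

Fixpoint exp1_tuple n : probability (n.-tuple R) R :=
  if n is n'.+1 then distribution (exp1 \x exp1_tuple n')%E (@cons_times n')
  else dirac [tuple].

End HoldingTimes.

Section WalkLaw.
Context (R : realType) (G : wgraph R).
Implicit Types (x : vert G) (A : set (cpath R G)).

(* The probability that the walk issued from x and stopped at its first vertex
   in the well follows exactly the edges es; recall that [jump_prob x e] is 0
   unless e is issued from x. *)
Fixpoint walk_prob x (es : seq (edge G)) : R :=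
  match es with
  | [::] => if x \in well G then 1 else 0
  | e :: es' => if x \in well G then 0 else jump_prob x e * walk_prob (tgt e) es'
  end.

(* The law of the path with edges es, independent exponential times before the
   last vertex, and infinite time at the last vertex. *)
Definition timed_law x n (es : n.-tuple (edge G)) A : \bar R :=
  exp1_tuple R n [set tau | slice x es A (tau, +oo%E)].

Definition walk_law x A : \bar R :=
  (\sum_(n <oo) \sum_(es : n.-tuple (edge G))
     (walk_prob x es)%:E * timed_law x es A)%E.

Lemma walk_prob_ge0 x es : 0 <= walk_prob x es.
Proof.
elim: es x => [|e es IH] x /=; first by case: ifP.
case: ifP => // _; rewrite mulr_ge0 // /jump_prob; case: ifP => // _.
by rewrite divr_ge0 ?sumr_ge0 // => *; rewrite ltW// cond_gt0.
Qed.

Section TimedLawMeasure.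
Variables (x : vert G) (n : nat) (es : n.-tuple (edge G)).

Let timed_law0 : timed_law x es set0 = 0%E.
Proof.
rewrite /timed_law (_ : [set _ | _] = set0) ?measure0//.
by apply/seteqP; split => // tau; rewrite /= slice0.
Qed.

Let timed_law_ge0 A : (0 <= timed_law x es A)%E.
Proof. exact: measure_ge0. Qed.

Let measurable_times A : measurable A ->
  measurable [set tau | slice x es A (tau, +oo%E)].
Proof.
move=> mA; rewrite -[X in measurable X]setTI.
by apply: (@measurable_fun_pair _ _ _ _ _ _ id (cst +oo%E)) => //; exact: mA.
Qed.

Let timed_law_sigma_additive : semi_sigma_additive (timed_law x es).
Proof.
move=> A mA tA mUA; rewrite /timed_law.
have -> : [set tau | slice x es (\bigcup_i A i) (tau, +oo%E)] =
    \bigcup_i [set tau | slice x es (A i) (tau, +oo%E)].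
  apply/seteqP; split => tau /=; first by rewrite slice_bigcup => -[i _]; exists i.
  by move=> [i _ ?]; rewrite slice_bigcup; exists i.
apply: measure_semi_sigma_additive => //.
- by move=> i; apply: measurable_times.
- move=> i j _ _ [tau [[g Aig gE] [g' Ajg' g'E]]].
  have gg' : g = g' by apply: val_inj => /=; rewrite gE.
  by apply: tA => //; exists g; split => //; rewrite gg'.
- apply: bigcupT_measurable => i; exact: measurable_times.
Qed.

HB.instance Definition _ := isMeasure.Build _ _ _ (timed_law x es)
  timed_law0 timed_law_ge0 timed_law_sigma_additive.

End TimedLawMeasure.

Section WalkLawMeasure.
Variable x : vert G.

Let scaled n (es : n.-tuple (edge G)) : {measure set (cpath R G) -> \bar R} :=
  mscale (NngNum (walk_prob_ge0 x es)) (timed_law x es).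

Let layer n (i : nat) : {measure set (cpath R G) -> \bar R} :=
  if insub i is Some o then scaled (enum_val (o : 'I_#|{: n.-tuple (edge G)}|))
  else mzero.

Let series n : {measure set (cpath R G) -> \bar R} :=
  msum (layer n) #|{: n.-tuple (edge G)}|.

Let walk_lawE : walk_law x = mseries series 0.
Proof.
apply/funext => A; rewrite /walk_law /mseries; apply: eq_eseriesr => n _.
rewrite /= /msum (reindex (@enum_val _ {: n.-tuple (edge G)})) /=; last first.
  exact/onW_bij/enum_val_bij.
by apply: eq_bigr => i _; rewrite /layer valK.
Qed.

Let walk_law0 : walk_law x set0 = 0%E.
Proof. by rewrite walk_lawE measure0. Qed.

Let walk_law_ge0 A : (0 <= walk_law x A)%E.
Proof. by rewrite walk_lawE measure_ge0. Qed.

Let walk_law_sigma_additive : semi_sigma_additive (walk_law x).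
Proof. by rewrite walk_lawE; exact: measure_semi_sigma_additive. Qed.

HB.instance Definition _ := isMeasure.Build _ _ _ (walk_law x)
  walk_law0 walk_law_ge0 walk_law_sigma_additive.

End WalkLawMeasure.

End WalkLaw.

(* Main.v *)
Require Import Defs.
From HB Require Import structures.
From mathcomp Require Import all_boot all_order all_algebra.
From mathcomp Require Import sesquilinear complex.
From mathcomp Require Import all_classical all_reals all_analysis.
From mathcomp Require Import measurable_realfun ring lra.
Set Implicit Arguments.
Unset Strict Implicit.
Unset Printing Implicit Defensive.
Import Order.TTheory GRing.Theory Num.Theory.
Import numFieldNormedType.Exports.
Local Open Scope classical_set_scope.
Local Open Scope ring_scope.

(** The expectation on the right-hand side is computed by conditioning on the
    first jump of the walk.  Started at a proper vertex x, the walk stays at x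
    up to time t with probability e^-t, which contributes
    e^-t e^(-t H_x) f(x).  Otherwise it leaves at a time s <= t through an edge
    e, and the holonomy along the reversed path splits off the factor
    e^(-s H_x) h_(e^-1); what remains is the same functional for the walk
    issued from the other end of e, on the time span t - s.  The semigroup
    v(t) = e^(-t Delta) f satisfies the same integral equation (Duhamel): with
    w(s) = e^-s e^(-s H_x) v(t - s, x), the derivative of w contains only the
    hopping terms of the Laplacian, and w(0) - w(t) is the integral of -w'.
    This is [heat_first_jump].

    Equality of the two solutions is obtained by induction on the number of
    steps of the walk, without a separate uniqueness argument.  Let U_N be the
    part of the expectation carried by the trajectories absorbed in the well in
    fewer than N steps, and let a_N(x) be the probability of not being absorbed
    in fewer than N steps.  Subtracting the two first-jump equations gives
    |v(t, x) - U_N(t, x)| <= a_N(x) C e^(g t)  ([partial_value_error]):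
    the weight a_N(x) is reproduced by the Markov property, and the factor
    e^(g t) is reproduced by one jump for the right choice of g
    ([growth_identity]).  As the graph is connected and the well is not empty,
    a_N tends to 0, by a maximum principle for the limit ([cvg_survive]), and
    U_N tends to the integral over all paths ([walk_law_limit]).

    All the analysis takes place in real coordinates.  A vector of a fibre of
    dimension r over R or C has 2 r real coordinates (the imaginary ones vanish
    in the real case), real-linear maps become real kernels, and e^(-s H_x) and
    e^(-t Delta) become exponentials of such kernels.  In these coordinates the
    result is [real_feynman_kac].  Norms are sup norms in an arbitrary basis, so
    the transports are only known to be bounded by some constant kappa >= 1,
    which is absorbed in the growth rate g = b + kappa - 1.

    The translation back to the bundle is combinatorial: [back_hol_truncate]
    shows that the holonomy along the reversed truncated path obeys the
    first-jump recursion. *)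

(** * Exponential generating functions *)

Section Egf.
Context {R : realType}.
Implicit Types (c : nat -> R) (t C b : R).

(** All the functions of time that have to be differentiated are of this form:
    differentiation is then a shift of the sequence of coefficients. *)
Definition egf c t : R := limn (pseries (fun n => (n`!%:R)^-1 * c n) t).

Definition geombound c C b := 0 <= b /\ forall n, `|c n| <= C * b ^+ n.

Lemma geombound_ge0 c C b : geombound c C b -> 0 <= C.
Proof. by case=> _ /(_ 0%N); rewrite expr0 mulr1; apply: le_trans. Qed.

Lemma geombound_shift c C b : geombound c C b ->
  geombound (fun n => c n.+1) (C * b) b.
Proof. by move=> [b0 H]; split => // n; rewrite -mulrA -exprS. Qed.

(** Termwise domination by the exponential series of C e^(b |t|), which gives
    both the convergence of the series and the bound on its sum. *)
Lemma egf_term_le c C b t n : geombound c C b ->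
  `|(n`!%:R)^-1 * c n * t ^+ n| <= C * exp_coeff (b * `|t|) n.
Proof.
move=> [b0 H]; rewrite !normrM normrX ger0_norm ?invr_ge0//.
rewrite exp_coeffE exprMn mulrCA -!mulrA ler_wpM2l ?invr_ge0//.
by rewrite mulrA ler_wpM2r// exprn_ge0.
Qed.

Lemma cvg_egf_norm c C b t : geombound c C b ->
  cvgn [normed (pseries (fun n => (n`!%:R)^-1 * c n) t)].
Proof.
move=> H; apply: (@series_le_cvg _ _ (fun n => C * exp_coeff (b * `|t|) n)) => //=.
- move=> n; rewrite mulr_ge0 ?(geombound_ge0 H)// exp_coeff_ge0// mulr_ge0//.
  by case: H.
- by move=> n; exact: egf_term_le.
- by apply: is_cvg_seriesZ; exact: is_cvg_series_exp_coeff.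
Qed.

Lemma is_cvg_egf c C b t : geombound c C b ->
  cvgn (pseries (fun n => (n`!%:R)^-1 * c n) t).
Proof. by move=> H; apply: normed_cvg; exact: cvg_egf_norm H. Qed.

Lemma egf_bound c C b t : geombound c C b -> `|egf c t| <= C * expR (b * `|t|).
Proof.
move=> H; apply: le_trans (lim_series_norm (cvg_egf_norm (t := t) H)) _.
have -> : C * expR (b * `|t|) = limn (series (fun n => C * exp_coeff (b * `|t|) n)).
  apply/esym/cvg_lim => //.
  rewrite (_ : series _ = fun n => C * series (exp_coeff (b * `|t|)) n).
    by apply: cvgMr; exact: is_cvg_series_exp_coeff.
  by apply/funext => n; rewrite /series /= mulr_sumr.
apply: lim_series_le; first exact: cvg_egf_norm H.
- by apply: is_cvg_seriesZ; exact: is_cvg_series_exp_coeff.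
- by move=> n; exact: egf_term_le.
Qed.

Lemma egf0 c : egf c 0 = c 0%N.
Proof.
apply/cvg_lim => //; rewrite -(cvg_shiftS _).
rewrite (_ : [sequence _]_n = fun=> c 0%N); first exact: cvg_cst.
apply/funext => n; rewrite /pseries /series /= big_nat_recl//= fact0 invr1 mul1r.
by rewrite expr0 mulr1 big1 ?addr0// => i _; rewrite exprS mul0r mulr0.
Qed.

Lemma pseries_diffs_egf c :
  pseries_diffs (fun n => (n`!%:R)^-1 * c n) = (fun n => (n`!%:R)^-1 * c n.+1).
Proof.
apply/funext => n; rewrite /pseries_diffs mulrA; congr (_ * _).
by rewrite factS natrM invfM mulVKf// pnatr_eq0.
Qed.

Lemma is_derive_egf c C b t : geombound c C b ->
  is_derive t (1 : R) (egf c) (egf (fun n => c n.+1) t).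
Proof.
move=> H; rewrite /egf -pseries_diffs_egf.
have H1 := geombound_shift H; have H2 := geombound_shift H1.
apply: (@pseries_snd_diffs _ _ (`|t| + 1)).
- exact: is_cvg_egf H.
- by rewrite pseries_diffs_egf; exact: is_cvg_egf H1.
- by rewrite !pseries_diffs_egf; exact: is_cvg_egf H2.
- by rewrite [ltRHS]ger0_norm ?ltrDl// addr_ge0.
Qed.

Lemma continuous_egf c C b : geombound c C b -> continuous (egf c).
Proof.
move=> H t; apply/differentiable_continuous/derivable1_diffP.
by have [] := is_derive_egf t H.
Qed.

Lemma egf_sum (I : finType) (a : I -> R) (c : I -> nat -> R) C b t :
  (forall j, geombound (c j) C b) ->
  egf (fun n => \sum_j a j * c j n) t = \sum_j a j * egf (c j) t.
Proof.
move=> H; apply/cvg_lim => //.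
rewrite (_ : pseries _ _ = fun m => \sum_j a j *
    pseries (fun n => (n`!%:R)^-1 * c j n) t m); last first.
  apply/funext => m; rewrite /pseries /series /=.
  under [RHS]eq_bigr do rewrite mulr_sumr.
  rewrite exchange_big /=; apply: eq_bigr => n _.
  by rewrite mulr_sumr mulr_suml; apply: eq_bigr => j _; ring.
apply: cvg_big => [|j _]; first exact: add_continuous.
apply: cvgMr; exact: is_cvg_egf (H j).
Qed.

End Egf.

(** * Integrals against the exponential law *)

Section Exp1.
Context {R : realType}.
Local Notation mu := (@lebesgue_measure R).
Local Notation exp1 := (@exp1 R).

Lemma exp1_dominates : exp1 `<< mu.
Proof.
apply/null_content_dominatesP => A mA muA0.
rewrite /exp1 /exponential_prob null_set_integral//.
by apply/measurable_funTS/measurable_EFinP; exact: measurable_exponential_pdf.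
Qed.

(** The exponential law is defined by the integrals of its density over sets.
    For integrals of functions the density is recovered, up to a null set, as
    the Radon-Nikodym derivative with respect to Lebesgue measure. *)
Lemma integral_exp1_density (U : set (measurableTypeR R)) (f : R -> R) :
  measurable U -> exp1.-integrable U (EFin \o f) ->
  (\int[exp1]_(x in U) (f x)%:E =
   \int[mu]_(x in U) (f x * exponential_pdf 1 x)%:E)%E.
Proof.
move=> mU intf.
rewrite -(Radon_Nikodym_change_of_variables exp1_dominates)//=.
under [RHS]eq_integral do rewrite EFinM.
have mf : measurable_fun U (EFin \o f) by exact: measurable_int intf.
apply: ae_eq_integral => //.
- apply: emeasurable_funM => //; apply: (measurable_int mu).
  apply: (integrableS _ _ (@subsetT _ _)) => //=.
  by apply: Radon_Nikodym_integrable; exact: exp1_dominates.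
- apply: emeasurable_funM => //=; apply/measurableT_comp => //=.
  by apply/measurable_funTS; exact: measurable_exponential_pdf.
- apply: ae_eqe_mul2l => /=.
  rewrite Radon_NikodymE//=; first exact: exp1_dominates.
  move=> dom.
  case: cid => /= h [h1 h2 h3].
  apply: integral_ae_eq => //=.
  + exact: integrableS h2.
  + by apply/measurable_funTS/measurableT_comp =>//; exact: measurable_exponential_pdf.
  + by move=> E E01 mE; rewrite -h3.
Qed.

Lemma exp1_integrable_continuous (t : R) (f : R -> R) : continuous f ->
  exp1.-integrable `[0, t] (EFin \o f).
Proof.
move=> cf; apply: measurable_bounded_integrable => //.
- by rewrite (le_lt_trans (probability_le1 _ _))// ltry.
- by apply: measurable_funTS; apply: continuous_measurable_fun.
- have /compact_bounded[M [Mr MP]] :=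
    continuous_compact (continuous_subspaceT (A := `[0, t]) cf) (@segment_compact _ 0 t).
  by exists M; split => // y My x xt; apply: MP My _ _; exists x.
Qed.

(** The only way in which integrals over the first holding time are evaluated:
    the density e^-s is included in the derivative of the primitive. *)
Lemma exp1_FTC (t : R) (w phi : R -> R) : 0 <= t -> continuous phi ->
  (forall s, is_derive s (1 : R) w (- (phi s * expR (- s)))) ->
  (\int[exp1]_(s in `[0, t]) phi s)%R = w 0 - w t.
Proof.
rewrite le_eqVlt => /predU1P[<-|t0] cphi dw.
  rewrite subrr set_itv1 /Rintegral integral_exp1_density; last 2 first.
  - exact: measurable_set1.
  - rewrite -set_itv1; exact: exp1_integrable_continuous.
  by rewrite integral_set1.
rewrite /Rintegral integral_exp1_density//; last exact: exp1_integrable_continuous.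
rewrite (_ : integral _ _ _ = \int[mu]_(x in `[0%R, t]) (phi x * expR (- x))%:E)%E; last first.
  apply: eq_integral => x; rewrite inE/= in_itv/= => /andP[x0 _].
  by rewrite exponential_pdfE// mul1r mulN1r.
have cE : continuous (fun x : R => phi x * expR (- x)).
  move=> x; apply: cvgM; first exact: cphi.
  apply: continuous_comp; first exact: opp_continuous.
  exact: continuous_expR.
have cw : continuous w.
  by move=> x; apply/differentiable_continuous/derivable1_diffP; case: (dw x).
rewrite (@continuous_FTC2 _ _ (fun s => - w s))//.
- by rewrite -EFinB/=; ring.
- exact: continuous_subspaceT.
- split.
  + move=> z _; apply: derivableN; by case: (dw z).
  + by apply/cvg_at_right_filter; apply: cvgN; exact: cw.
  + by apply/cvg_at_left_filter; apply: cvgN; exact: cw.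
- move=> z _; rewrite derive1E deriveN; last by case: (dw z).
  by have [_ ->] := dw z; rewrite opprK.
Qed.

Lemma exp1_itv (t : R) : 0 <= t -> exp1 `[0, t] = (1 - expR (- t))%:E.
Proof.
move=> t0; have : (\int[exp1]_(s in `[0, t]) 1)%R = expR (- 0) - expR (- t).
  apply: (@exp1_FTC t (fun s => expR (- s)) (cst 1)) => //.
    exact: cst_continuous.
  move=> s; rewrite mul1r -mulrN1; exact: is_derive1_comp.
rewrite Rintegral_cst// mul1r oppr0 expR0 => <-.
by rewrite fineK// fin_num_measure.
Qed.

(** The value a is that of a path which does not jump before t; a negative
    holding time also falls in this case, and has probability 0. *)
Lemma Rintegral_exp1_split (t a : R) (phi : R -> R) : 0 <= t ->
  exp1.-integrable `[0, t] (EFin \o phi) ->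
  exp1.-integrable setT (fun s => (if 0 <= s <= t then phi s else a)%:E) /\
  (\int[exp1]_s (if 0 <= s <= t then phi s else a))%R =
     expR (- t) * a + (\int[exp1]_(s in `[0, t]) phi s)%R.
Proof.
move=> t0 iphi; set F := (X in integrable _ _ X).
have mI : @measurable _ (measurableTypeR R) `[0, t] by exact: measurable_itv.
have iF1 : exp1.-integrable `[0, t] F.
  apply: eq_integrable iphi => // s; rewrite inE /= in_itv /= /F => ->; by [].
have iF2 : exp1.-integrable (~` `[0, t]) F.
  apply: (@eq_integrable _ _ _ _ _ _ (cst a%:E)) => //.
  - exact: measurableC.
  - by move=> s; rewrite inE /= in_itv /= /F => /negP/negbTE ->.
  - by apply: finite_measure_integrable_cst; exact: measurableC.
have iF : exp1.-integrable setT F.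
  rewrite (_ : F = (F \_ `[0%R, t]) \+ (F \_ (~` `[0%R, t])))%E; last first.
    apply/funext => s; rewrite !patchE in_setC.
    by case: (s \in _); rewrite ?adde0 ?add0e.
  have mC := measurableC mI.
  by apply: integrableD => //;
    [exact: (proj1 (integrable_mkcond F mI) iF1)|exact: (proj1 (integrable_mkcond F mC) iF2)].
split => //; rewrite -[in LHS](setUv `[0, t]) Rintegral_setU//.
- rewrite addrC; congr (_ + _).
    rewrite (@eq_Rintegral _ _ _ _ _ (cst a)); last first.
      by move=> s; rewrite inE/= in_itv/= => /negP/negbTE ->.
    rewrite Rintegral_cst; last exact: measurableC.
    rewrite mulrC; congr (_ * _).
    have : exp1 (~` `[0%R, t]) = (expR (- t))%:E.
      transitivity (1 - exp1 `[0%R, t])%E; first exact: probability_setC.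
      by rewrite exp1_itv// -EFinB/=; congr EFin; ring.
    by move=> /(congr1 fine).
  by apply: eq_Rintegral => s; rewrite inE/= in_itv/= => ->.
- exact: measurableC.
- by rewrite setUv.
- exact/disj_setPCl.
Qed.

End Exp1.

(** * Absorption of the walk in the well *)

Section Absorption.

Lemma big_tupleS (V : nmodType) (T : finType) n (F : seq T -> V) :
  \sum_(es : n.+1.-tuple T) F es = \sum_e \sum_(es : n.-tuple T) F (e :: es).
Proof.
rewrite pair_big/= (reindex (fun p : T * n.-tuple T => [tuple of p.1 :: p.2]))//.
exists (fun es : n.+1.-tuple T => (thead es, [tuple of behead es])).
  by move=> [e es] _ /=; rewrite theadE; congr pair; apply: val_inj.
by move=> es _; rewrite [RHS]tuple_eta; apply: val_inj.
Qed.

Lemma big_tuple0 (V : nmodType) (T : finType) (F : seq T -> V) :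
  \sum_(es : 0.-tuple T) F es = F [::].
Proof.
by rewrite (big_pred1 [tuple])// => es; rewrite [es]tuple0 /= eqxx.
Qed.

Context {R : realType} {G : wgraph R}.
Implicit Types (x : vert G) (e : edge G).

Lemma jump_prob_ge0 x e : 0 <= jump_prob x e.
Proof.
rewrite /jump_prob; case: ifP => // _.
by rewrite divr_ge0 ?sumr_ge0 // => *; rewrite ltW// cond_gt0.
Qed.

Lemma jump_prob_gt0 e : 0 < jump_prob (src e) e.
Proof.
rewrite /jump_prob eqxx divr_gt0 ?cond_gt0// /lam (bigD1 e)//=.
by rewrite ltr_pwDl ?cond_gt0// sumr_ge0 // => *; rewrite ltW// cond_gt0.
Qed.

Lemma sum_jump_prob x : x \notin well G -> \sum_e jump_prob x e = 1.
Proof.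
move=> xW; have /set0Pn[w wW] := well_neq0 G.
have [e ex] : exists e, src e = x.
  case/connectP: (wgraph_connected x w) => -[/= _ xw|y p /= /andP[xy _] _].
    by rewrite -xw wW in xW.
  by have /existsP[e /andP[/eqP <- _]] := xy; exists e.
have lam0 : lam x != 0.
  rewrite gt_eqF// /lam (bigD1 e)/= ?ex//.
  by rewrite ltr_pwDl ?cond_gt0// sumr_ge0 // => *; rewrite ltW// cond_gt0.
rewrite -[RHS](divff lam0) {2}/lam mulr_suml [RHS]big_mkcond/=.
by apply: eq_bigr => e' _; rewrite /jump_prob.
Qed.

Definition absorbed N x : R :=
  \sum_(n < N) \sum_(es : n.-tuple (edge G)) walk_prob x es.

(** The probability of not being absorbed in fewer than N steps, expressed by
    complementation since only absorbed trajectories carry a probability in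
    [walk_law]. *)
Definition survive N x : R := 1 - absorbed N x.

Lemma absorbedS N x : x \notin well G ->
  absorbed N.+1 x = \sum_e jump_prob x e * absorbed N (tgt e).
Proof.
move=> xW; rewrite /absorbed big_ord_recl big_tuple0 /= (negbTE xW) add0r.
under [RHS]eq_bigr do rewrite mulr_sumr.
rewrite exchange_big; apply: eq_bigr => n _ /=.
rewrite (big_tupleS _ (walk_prob x)); apply: eq_bigr => e _.
by rewrite mulr_sumr; apply: eq_bigr => es _; rewrite /= (negbTE xW).
Qed.

Lemma surviveS N x : survive N.+1 x =
  if x \in well G then 0 else \sum_e jump_prob x e * survive N (tgt e).
Proof.
case: ifPn => xW; last first.
  rewrite {1}/survive absorbedS// -(sum_jump_prob xW) -sumrB.
  by apply: eq_bigr => e _; rewrite mulrBr mulr1.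
rewrite /survive /absorbed big_ord_recl big_tuple0 /= xW big1 ?addr0 ?subrr//.
by move=> n _; rewrite (big_tupleS _ (walk_prob x)) big1// => e _; rewrite big1//= xW.
Qed.

Lemma survive0 x : survive 0 x = 1.
Proof. by rewrite /survive /absorbed big_ord0 subr0. Qed.

Lemma survive_ge0 N x : 0 <= survive N x.
Proof.
elim: N x => [|N IH] x; first by rewrite survive0.
by rewrite surviveS; case: ifP => // _; apply: sumr_ge0 => e _; rewrite mulr_ge0 ?jump_prob_ge0.
Qed.

Lemma survive_nonincreasing x : nonincreasing_seq (survive^~ x).
Proof.
apply/nonincreasing_seqP => N; rewrite /survive /absorbed lerB//.
rewrite [leRHS]big_ord_recr/= lerDl; apply: sumr_ge0 => es _; exact: walk_prob_ge0.
Qed.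

(** The limit L of these nonincreasing sequences vanishes on the well and is
    harmonic outside it, for the transition probabilities of the walk.  If its
    maximum were positive, then it would be attained outside the well, hence,
    every edge having a positive probability, at all the neighbours, and by
    connectedness in the well too. *)
Lemma cvg_survive x : survive N x @[N --> \oo] --> 0.
Proof.
pose L y := limn (survive^~ y).
have cL y : survive N y @[N --> \oo] --> L y.
  apply: nonincreasing_is_cvgn; first exact: survive_nonincreasing.
  by exists 0 => _ [N _ <-]; exact: survive_ge0.
have L_ge0 y : 0 <= L y by apply: limr_ge; [exact: cL|near=> N; exact: survive_ge0].
have LW y : y \in well G -> L y = 0.
  move=> yW; apply: cvg_lim => //; rewrite -(cvg_shiftS _).
  rewrite (_ : [sequence _]_n = cst 0); first exact: cvg_cst.
  by apply/funext => N /=; rewrite surviveS yW.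
have Lharm y : y \notin well G -> L y = \sum_e jump_prob y e * L (tgt e).
  move=> yW; apply: cvg_lim => //; rewrite -(cvg_shiftS _).
  rewrite (_ : [sequence _]_n = fun N => \sum_e jump_prob y e * survive N (tgt e)).
    apply: cvg_big => [|e _]; first exact: add_continuous.
    by apply: cvgMr; exact: cL.
  by apply/funext => N /=; rewrite surviveS (negbTE yW).
(* a maximum of L outside the well propagates along edges *)
pose m := [arg max_(y > x) L y]%O.
have mmax y : L y <= L m by rewrite /m; case: Order.TotalTheory.arg_maxP => // i _; apply.
have prop y z : L y = L m -> 0 < L m -> adj y z -> L z = L m.
  move=> ym m0 /existsP[e /andP[/eqP ey /eqP ez]].
  have yW : y \notin well G by apply: contraTN m0 => yW; rewrite -ym LW// ltxx.
  apply/eqP; rewrite eq_le mmax/= leNgt; apply/negP => zm.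
  have : L y < \sum_e jump_prob y e * L m.
    rewrite Lharm// (bigD1 e)//= [ltRHS](bigD1 e)//= ltr_leD//.
      by rewrite ltr_pM2l ?ez// -ey jump_prob_gt0.
    by apply: ler_sum => e' _; rewrite ler_wpM2l// jump_prob_ge0.
  by rewrite -mulr_suml sum_jump_prob// mul1r ym ltxx.
have m0 : L m = 0.
  apply/eqP; rewrite eq_le L_ge0 andbT leNgt; apply/negP => m0.
  have /set0Pn[w wW] := well_neq0 G.
  have prop_path p : forall y, L y = L m -> path (@adj G) y p -> L (last y p) = L m.
    elim: p => //= z p IH y ym /andP[yz zp].
    by apply: IH => //; exact: prop yz.
  have : L w = L m.
    by case/connectP: (wgraph_connected m w) => p mp ->; exact: prop_path.
  by move=> wm; move: m0; rewrite -wm LW// ltxx.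
suff <- : L x = 0 by exact: cL.
by apply/eqP; rewrite eq_le L_ge0 -m0 mmax.
Unshelve. all: by end_near. Qed.

End Absorption.

(** * Finite sums of integrals *)

Section RintegralSum.
Context d (T : measurableType d) (R : realType) (mu : {measure set T -> \bar R}).

Lemma integrable_sumr (I : Type) (s : seq I) (D : set T) (f : I -> T -> R) :
  measurable D -> (forall j, mu.-integrable D (EFin \o f j)) ->
  mu.-integrable D (EFin \o (fun x => \sum_(j <- s) f j x)).
Proof.
move=> mD H; apply: (@eq_integrable _ _ _ _ _ mD (fun x => \sum_(j <- s) (f j x)%:E)%E).
  by move=> x _; rewrite /= sumEFin.
by apply: integrable_sum => // j _; exact: H.
Qed.

Lemma Rintegral_sum (I : Type) (s : seq I) (D : set T) (f : I -> T -> R) :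
  measurable D -> (forall j, mu.-integrable D (EFin \o f j)) ->
  (\int[mu]_(x in D) (\sum_(j <- s) f j x) = \sum_(j <- s) \int[mu]_(x in D) f j x)%R.
Proof.
move=> mD H; elim: s => [|j s IH].
  by under eq_Rintegral do rewrite big_nil; rewrite big_nil Rintegral_cst// mul0r.
under eq_Rintegral do rewrite big_cons.
by rewrite big_cons RintegralD// ?IH//; exact: integrable_sumr.
Qed.

Lemma integrable_mulrl (D : set T) (a : R) (f : T -> R) : measurable D ->
  mu.-integrable D (EFin \o f) -> mu.-integrable D (EFin \o (fun x => a * f x)).
Proof. by move=> mD; exact: integrableZl. Qed.

End RintegralSum.

(** * The functional of a path, in real coordinates *)

Section FirstJump.
Context {R : realType} {G : wgraph R} {I : finType}.
Variables (c : vert G -> R -> I -> R) (K : edge G -> R -> I -> I -> R).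

(** The coordinates of the functional of a path as a recursion over its first
    jump: c is the contribution of a path that has not jumped up to time t, and
    K e s is the effect of waiting for a time s and then crossing e.  The test
    0 <= s makes the time that is left belong to [0, t] for all holding times,
    so that bounds valid for nonnegative times can be used inductively. *)
Fixpoint path_value (x : vert G) (es : seq (edge G)) (ts : seq R) (t : R) : I -> R :=
  match es, ts with
  | e :: es', s :: ts' =>
      if 0 <= s <= t then
        fun i => \sum_j K e s i j * path_value (tgt e) es' ts' (t - s) j
      else c x t
  | _, _ => c x t
  end.

Hypothesis c_meas : forall x i, measurable_fun setT (fun t => c x t i).
Hypothesis K_meas : forall e i j, measurable_fun setT (fun s => K e s i j).

(** Joint measurability in t and the holding times is needed even if t is
    fixed, as the recursion changes t into t - s. *)
Lemma measurable_path_value n es x i :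
  measurable_fun setT (fun p : R * n.-tuple R => path_value x es p.2 p.1 i).
Proof.
elim: n es x i => [|n IH] es x i.
  rewrite (_ : (fun _ => _) = (fun p : R * 0.-tuple R => c x p.1 i)).
    by apply: (measurableT_comp (c_meas x i)); exact: measurable_fst.
  by apply/funext => -[t ts] /=; rewrite [ts]tuple0; case: es.
case: es => [|e es] /=.
  by apply: (measurableT_comp (c_meas x i)); exact: measurable_fst.
rewrite (_ : (fun _ => _) = (fun p : R * n.+1.-tuple R =>
    if (0 <= tnth p.2 ord0) && (tnth p.2 ord0 <= p.1) then
      \sum_j K e (tnth p.2 ord0) i j *
        path_value (tgt e) es [tuple of behead p.2] (p.1 - tnth p.2 ord0) j
    else c x p.1 i)); last first.
  apply/funext => -[t ts] /=; rewrite [ts in LHS]tuple_eta /=.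
  by rewrite (tnth_nth 0) [ts in RHS]tuple_eta /=; case: ifP.
have mhd : measurable_fun setT (fun p : R * n.+1.-tuple R => tnth p.2 ord0).
  exact: (measurableT_comp (measurable_tnth ord0) measurable_snd).
have m1 : measurable_fun setT (fun p : R * n.+1.-tuple R => p.1).
  exact: measurable_fst.
apply: measurable_fun_ifT.
- by apply: measurable_and; apply: measurable_fun_ler => //; exact: measurable_cst.
- apply: measurable_sum => j; apply: measurable_funM.
    exact: (measurableT_comp (K_meas e i j)).
  pose sub p : R * n.-tuple R :=
    ((p : R * n.+1.-tuple R).1 - tnth p.2 ord0, [tuple of behead p.2]).
  apply: (measurableT_comp (IH es (tgt e) j) (_ : measurable_fun setT sub)).
  apply: measurable_fun_pair => /=; first exact: measurable_funB.
  exact: (measurableT_comp (@measurable_behead _ _ n) measurable_snd).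
- exact: (measurableT_comp (c_meas x i)).
Qed.

Lemma measurable_path_value_times n es x t i :
  measurable_fun setT (fun ts : n.-tuple R => path_value x es ts t i).
Proof.
pose pr ts : R * n.-tuple R := (t, ts).
apply: (measurableT_comp (measurable_path_value es x i) (_ : measurable_fun setT pr)).
by apply: measurable_fun_pair => //; exact: measurable_cst.
Qed.

End FirstJump.

(** * Expectations over the holding times *)

Section FirstJumpIntegral.
Context {R : realType}.
Local Notation exp1 := (@exp1 R).

Lemma ge0_integral_exp1_tupleS n (f : n.+1.-tuple R -> \bar R) :
  measurable_fun setT f -> (forall ts, 0 <= f ts)%E ->
  (\int[exp1_tuple R n.+1]_ts f ts =
   \int[exp1]_s \int[exp1_tuple R n]_ts f (cons_tuple s ts))%E.
Proof.
move=> mf f0.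
rewrite [LHS](ge0_integral_distribution (@cons_times R n))//.
rewrite fubini_tonelli1// => [|p]; last exact: f0.
by apply: measurableT_comp => //; exact: measurable_cons_times.
Qed.

(** The law of n + 1 holding times is an image of a product measure, so that
    integration over the first holding time can be separated by Fubini. *)
Lemma integral_exp1_tupleS n (f : n.+1.-tuple R -> \bar R) :
  (exp1_tuple R n.+1).-integrable setT f ->
  exp1.-integrable setT (fun s => \int[exp1_tuple R n]_ts f (cons_tuple s ts))%E /\
  (\int[exp1_tuple R n.+1]_ts f ts =
   \int[exp1]_s \int[exp1_tuple R n]_ts f (cons_tuple s ts))%E.
Proof.
move=> intf; have mf := measurable_int _ intf.
have intfc : ((exp1 \x exp1_tuple R n)%E).-integrable setT (f \o @cons_times R n).
  apply/integrableP; split.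
    by apply: measurableT_comp => //; exact: measurable_cons_times.
  have /integrableP[_] := intf.
  rewrite [X in (X < _)%E -> _](ge0_integral_distribution (@cons_times R n))//.
  exact: measurableT_comp.
split; first exact: integrable_fubini_F intfc.
rewrite [LHS](@integral_distribution _ _ _ _ _ _ (@cons_times R n))//.
by rewrite -integral12_prod_meas1.
Qed.

Context {G : wgraph R} {I : finType}.
Variables (c : vert G -> R -> I -> R) (K : edge G -> R -> I -> I -> R).
Variables (b kappa C : R).
Hypothesis kappa_ge1 : 1 <= kappa.
Hypothesis C_ge0 : 0 <= C.
Hypothesis c_meas : forall x i, measurable_fun setT (fun t => c x t i).
Hypothesis K_meas : forall e i j, measurable_fun setT (fun s => K e s i j).
Hypothesis c_bound : forall x t i, 0 <= t -> `|c x t i| <= C * expR (b * t).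
Hypothesis K_bound : forall e s u y, 0 <= s -> (forall j, `|u j| <= y) ->
  forall i, `|\sum_j K e s i j * u j| <= kappa * expR (b * s) * y.

Let kappa_ge0 : 0 <= kappa. Proof. exact: le_trans kappa_ge1. Qed.

(** The rate g for which t |-> C e^(g t) is a fixed point of the first-jump
    recursion of [majorant]. *)
Definition growth := b + kappa - 1.

(** The scalar functional with c = C e^(b t) and K = kappa e^(b s), which
    dominates the given one; being a [path_value], it is measurable for free. *)
Definition majorant : vert G -> seq (edge G) -> seq R -> R -> R := fun x es ts t =>
  path_value (fun _ t (_ : unit) => C * expR (b * t))
    (fun _ s _ _ => kappa * expR (b * s)) x es ts t tt.

Lemma majorantS x e es s ts t : majorant x (e :: es) (s :: ts) t =
  if 0 <= s <= t then kappa * expR (b * s) * majorant (tgt e) es ts (t - s)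
  else C * expR (b * t).
Proof. by rewrite /majorant /=; case: ifP => // _; rewrite (big_pred1 tt)// => -[]. Qed.

Lemma majorant_ge0 x es ts t : 0 <= majorant x es ts t.
Proof.
have base x' t' : 0 <= C * expR (b * t') by rewrite mulr_ge0// expR_ge0.
elim: es x ts t => [|e es IH] x [|s ts] t; try exact: base.
by rewrite majorantS; case: ifP => // _; rewrite !mulr_ge0// expR_ge0.
Qed.

Lemma path_value_le_majorant x es ts t i : 0 <= t ->
  `|path_value c K x es ts t i| <= majorant x es ts t.
Proof.
elim: es x ts t i => [|e es IH] x [|s ts] t i t0; try exact: c_bound.
rewrite majorantS /=; case: ifPn => [/andP[s0 st]|_]; last exact: c_bound.
by apply: K_bound => // j; apply: IH; rewrite subr_ge0.
Qed.

(** With w(s) = a e^(g t - kappa s) one has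
    w'(s) = - kappa e^(b s) a e^(g (t - s)) e^-s, because b - 1 - g = - kappa. *)
Lemma growth_identity a t : 0 <= t ->
  exp1.-integrable `[0, t] (EFin \o
    (fun s => kappa * expR (b * s) * (a * expR (growth * (t - s))))) /\
  (\int[exp1]_(s in `[0, t]) (kappa * expR (b * s) * (a * expR (growth * (t - s)))) =
    a * expR (growth * t) - expR (- t) * (a * expR (b * t)))%R.
Proof.
move=> t0.
have cphi : continuous (fun s => kappa * expR (b * s) * (a * expR (growth * (t - s)))).
  move=> s; apply: cvgM; apply: cvgMr.
    by apply: continuous_comp; [exact: cvgMr|exact: continuous_expR].
  apply: continuous_comp; last exact: continuous_expR.
  by apply: cvgMr; apply: cvgB => //; exact: cvg_cst.
split; first exact: exp1_integrable_continuous.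
pose w s := a * expR (growth * t - kappa * s).
have dw s : is_derive s (1 : R) w
    (- (kappa * expR (b * s) * (a * expR (growth * (t - s))) * expR (- s))).
  have -> : - (kappa * expR (b * s) * (a * expR (growth * (t - s))) * expR (- s)) =
      a *: (expR (growth * t - kappa * s) * - kappa).
    have -> : growth * t - kappa * s = b * s + growth * (t - s) + - s by rewrite /growth; ring.
    by rewrite !expRD/= /GRing.scale/=; ring.
  apply: is_deriveZ; apply: is_derive1_comp.
  rewrite -[X in is_derive _ _ _ X]add0r; apply: is_deriveB.
  by rewrite -[X in is_derive _ _ _ X]mulr1; exact: is_deriveZ.
rewrite (exp1_FTC t0 cphi dw) /w mulr0 subr0; congr (_ - _); rewrite mulrCA -expRD.
by congr (_ * expR _); rewrite /growth; ring.
Qed.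

Lemma measurable_majorant n es x :
  measurable_fun setT (fun p : R * n.-tuple R => majorant x es p.2 p.1).
Proof.
have mE (y : R) : measurable_fun setT (fun t => y * expR (b * t)).
  apply: continuous_measurable_fun => t; apply: cvgMr.
  by apply: continuous_comp; [exact: cvgMr|exact: continuous_expR].
by apply: measurable_path_value => *; exact: mE.
Qed.

Lemma measurable_majorant_times n es x t :
  measurable_fun setT (fun ts : n.-tuple R => majorant x es ts t).
Proof.
pose pr ts : R * n.-tuple R := (t, ts).
apply: (measurableT_comp (measurable_majorant es x) (_ : measurable_fun setT pr)).
by apply: measurable_fun_pair => //; exact: measurable_cst.
Qed.

(** A bound that depends neither on the edges nor on their number.  For n = 0
    it is here that kappa >= 1, that is b <= g, is used. *)
Lemma integral_majorant n es x t : size es = n -> 0 <= t ->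
  (\int[exp1_tuple R n]_ts (majorant x es ts t)%:E <= (C * expR (growth * t))%:E)%E.
Proof.
move=> + t0; elim: n es x t t0 => [|n IH] [|e es]//= x t t0 => [_|[esn]].
  rewrite (@eq_integral _ _ _ _ _ (cst (C * expR (b * t))%:E)); last first.
    by move=> ts _; rewrite [ts]tuple0.
  rewrite integral_cst//= probability_setT mule1 lee_fin ler_wpM2l// ler_expR.
  by rewrite ler_wpM2r// /growth; move: kappa_ge1; lra.
rewrite ge0_integral_exp1_tupleS; last 2 first.
- by apply/measurable_EFinP; exact: measurable_majorant_times.
- by move=> ts; rewrite lee_fin majorant_ge0.
have [iphi phiE] := growth_identity C t0.
have [iF FE] := Rintegral_exp1_split (C * expR (b * t)) t0 iphi.
have -> : (C * expR (growth * t))%:E =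
    (\int[exp1]_s (if (0 <= s <= t)%R then kappa * expR (b * s) * (C * expR (growth * (t - s)))
       else C * expR (b * t))%:E)%E.
  rewrite -[RHS]fineK; last exact: integrable_fin_num.
  rewrite -/(Rintegral _ _ _) FE phiE; congr EFin; ring.
apply: ge0_le_integral => //.
- by move=> s _; apply: integral_ge0 => ts _; rewrite lee_fin majorant_ge0.
- apply: (measurable_fun_fubini_tonelli_F
    (fun p => (majorant x (e :: es) (@cons_times R n p) t)%:E)).
    apply/measurable_EFinP.
    apply: (measurableT_comp (measurable_majorant_times (e :: es) x t)).
    exact: measurable_cons_times.
  by move=> p; rewrite lee_fin majorant_ge0.
- exact: measurable_int iF.
move=> s _; case: ifPn => st; last first.
  under eq_integral do rewrite majorantS (negbTE st).
  by rewrite integral_cst// [X in (_ * X)%E]probability_setT mule1.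
under eq_integral do rewrite majorantS st EFinM.
have /andP[s0 s_le_t] := st.
rewrite ge0_integralZl//; last 3 first.
- by apply/measurable_EFinP; exact: measurable_majorant_times.
- by move=> ts _; rewrite lee_fin majorant_ge0.
- by rewrite lee_fin mulr_ge0// expR_ge0.
rewrite [leRHS]EFinM lee_pmul//.
- by rewrite lee_fin mulr_ge0// expR_ge0.
- by apply: integral_ge0 => ts _; rewrite lee_fin majorant_ge0.
- by apply: IH => //; rewrite subr_ge0.
Qed.

Lemma integrable_path_value n es x t i : size es = n -> 0 <= t ->
  (exp1_tuple R n).-integrable setT (EFin \o (fun ts => path_value c K x es ts t i)) /\
  (\int[exp1_tuple R n]_ts `|path_value c K x es ts t i|%:E
     <= (C * expR (growth * t))%:E)%E.
Proof.
move=> esn t0; set B := (_ <= _)%E.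
have HB : B.
  apply: le_trans (integral_majorant x esn t0); apply: ge0_le_integral => //.
  - apply/measurable_EFinP; apply: measurableT_comp => //.
    exact: measurable_path_value_times.
  - by apply/measurable_EFinP; exact: measurable_majorant_times.
  - by move=> ts _; rewrite lee_fin path_value_le_majorant.
split => //; apply/integrableP; split.
  by apply/measurable_EFinP; exact: measurable_path_value_times.
by apply: (le_lt_trans HB); rewrite ltry.
Qed.

End FirstJumpIntegral.

(** * First-jump analysis and convergence *)

Section Convergence.
Context {R : realType} {G : wgraph R} {I : finType}.
Local Notation exp1 := (@exp1 R).
Variables (c : vert G -> R -> I -> R) (K : edge G -> R -> I -> I -> R).
Variables (b kappa C : R).
Hypothesis kappa_ge1 : 1 <= kappa.
Hypothesis C_ge0 : 0 <= C.
Hypothesis c_meas : forall x i, measurable_fun setT (fun t => c x t i).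
Hypothesis K_meas : forall e i j, measurable_fun setT (fun s => K e s i j).
Hypothesis c_bound : forall x t i, 0 <= t -> `|c x t i| <= C * expR (b * t).
Hypothesis K_bound : forall e s u y, 0 <= s -> (forall j, `|u j| <= y) ->
  forall i, `|\sum_j K e s i j * u j| <= kappa * expR (b * s) * y.

Definition mean_value n x es t i : R :=
  (\int[exp1_tuple R n]_ts path_value c K x es ts t i)%R.

Let integrable_pv n es x t i : size es = n -> 0 <= t ->
  (exp1_tuple R n).-integrable setT (EFin \o (fun ts => path_value c K x es ts t i)).
Proof.
move=> esn t0.
by case: (integrable_path_value kappa_ge1 C_ge0 c_meas K_meas c_bound K_bound x i esn t0).
Qed.

Lemma mean_value0 x t i : mean_value 0 x [::] t i = c x t i.
Proof.
rewrite /mean_value (@eq_Rintegral _ _ _ _ _ (cst (c x t i)))//.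
by rewrite Rintegral_cst// [X in fine X]probability_setT mulr1.
Qed.

(** First-jump equation for the walk conditioned to follow given edges. *)
Lemma mean_valueS n x e es t i : size es = n -> 0 <= t ->
  let phi s := \sum_j K e s i j * mean_value n (tgt e) es (t - s) j in
  exp1.-integrable `[0, t] (EFin \o phi) /\
  mean_value n.+1 x (e :: es) t i =
    expR (- t) * c x t i + (\int[exp1]_(s in `[0, t]) phi s)%R.
Proof.
move=> esn t0 phi.
have [iF FE] := integral_exp1_tupleS
  (@integrable_pv n.+1 (e :: es) x t i (congr1 S esn) t0).
have innerE s : (\int[exp1_tuple R n]_ts
    (path_value c K x (e :: es) (cons_tuple s ts) t i)%:E)%E =
    (if 0 <= s <= t then phi s else c x t i)%:E.
  rewrite /=; case: ifP => [/andP[s0 st]|_]; last first.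
    by rewrite integral_cst// [X in (_ * X)%E]probability_setT mule1.
  have int_j j : (exp1_tuple R n).-integrable setT (EFin \o
      (fun ts => K e s i j * path_value c K (tgt e) es ts (t - s) j)).
    by apply: integrable_mulrl => //; apply: integrable_pv; rewrite ?subr_ge0.
  rewrite -[LHS]fineK; last by apply: integrable_fin_num => //; exact: integrable_sumr.
  congr EFin; rewrite -/(Rintegral _ _ _) Rintegral_sum//.
  apply: eq_bigr => j _; rewrite RintegralZl//.
  by apply: integrable_pv; rewrite ?subr_ge0.
have iphi : exp1.-integrable `[0, t] (EFin \o phi).
  have : exp1.-integrable `[0, t] (fun s => \int[exp1_tuple R n]_ts
    (path_value c K x (e :: es) (cons_tuple s ts) t i)%:E)%E by exact: integrableS iF.
  by apply: eq_integrable => // s; rewrite inE/= in_itv/= innerE => ->.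
split=> //; have [_ <-] := Rintegral_exp1_split (c x t i) t0 iphi.
rewrite /mean_value /Rintegral [X in fine X]FE; congr fine.
by apply: eq_integral => s _; exact: innerE.
Qed.

(** The contribution of the trajectories absorbed in fewer than N steps. *)
Definition partial_value N x t i : R :=
  \sum_(n < N) \sum_(es : n.-tuple (edge G)) walk_prob x es * mean_value n x es t i.

Lemma partial_value_well N x t i : x \in well G -> c x t i = 0 ->
  partial_value N x t i = 0.
Proof.
move=> xW cx0; rewrite /partial_value big1// => -[[|n] nN] _ /=.
  rewrite [LHS](big_tuple0 (fun es => walk_prob x es * mean_value 0 x es t i)).
  by rewrite mean_value0 cx0 mulr0.
rewrite [LHS](big_tupleS _ (fun es => walk_prob x es * mean_value n.+1 x es t i)) big1// => e _.
by rewrite big1// => es _; rewrite /= xW mul0r.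
Qed.

(** The first-jump equation truncated at N + 1 steps.  The term without jump is
    weighted by the probability that the remaining steps are fewer than N; the
    missing mass is accounted for in [partial_value_error]. *)
Lemma partial_valueS N x t i : x \notin well G -> 0 <= t ->
  let phi e s := \sum_j K e s i j * partial_value N (tgt e) (t - s) j in
  (forall e, exp1.-integrable `[0, t] (EFin \o phi e)) /\
  partial_value N.+1 x t i = \sum_e jump_prob x e *
    (absorbed N (tgt e) * (expR (- t) * c x t i) +
     (\int[exp1]_(s in `[0, t]) phi e s)%R).
Proof.
move=> xW t0 phi.
pose psi e n (es : seq (edge G)) s :=
  walk_prob (tgt e) es * \sum_j K e s i j * mean_value n (tgt e) es (t - s) j.
have ipsi e n (es : n.-tuple (edge G)) : exp1.-integrable `[0, t] (EFin \o psi e n es).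
  apply: integrable_mulrl => //.
  by have [] := mean_valueS x e i (size_tuple es) t0.
have phiE e : phi e = fun s => \sum_(n < N) \sum_(es : n.-tuple (edge G)) psi e n es s.
  apply/funext => s; rewrite /phi /partial_value.
  under eq_bigr do rewrite mulr_sumr.
  rewrite exchange_big; apply: eq_bigr => n _ /=.
  under eq_bigr do rewrite mulr_sumr.
  rewrite exchange_big; apply: eq_bigr => es _ /=.
  by rewrite /psi mulr_sumr; apply: eq_bigr => j _; ring.
have isum e n : exp1.-integrable `[0, t]
    (EFin \o (fun s => \sum_(es : n.-tuple (edge G)) psi e n es s)).
  by apply: integrable_sumr => // es; exact: ipsi.
split=> [e|].
  by rewrite phiE; apply: integrable_sumr => // n; exact: isum.
rewrite {1}/partial_value big_ord_recl.
rewrite [X in X + _](big_tuple0 (fun es => walk_prob x es * mean_value 0 x es t i))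
  /= (negbTE xW) mul0r add0r.
transitivity (\sum_(n < N) \sum_e \sum_(es : n.-tuple (edge G))
    jump_prob x e * (walk_prob (tgt e) es * (expR (- t) * c x t i) +
      (\int[exp1]_(s in `[0, t]) psi e n es s)%R)).
  apply: eq_bigr => n _.
  rewrite [LHS](big_tupleS _ (fun es => walk_prob x es * mean_value n.+1 x es t i)).
  apply: eq_bigr => e _; apply: eq_bigr => es _ /=; rewrite (negbTE xW).
  have [iphi ->] := mean_valueS x e i (size_tuple es) t0.
  by rewrite -mulrA mulrDr RintegralZl.
rewrite exchange_big; apply: eq_bigr => e _ /=; rewrite phiE Rintegral_sum//.
rewrite /absorbed mulr_suml -big_split/= mulr_sumr; apply: eq_bigr => n _.
by rewrite Rintegral_sum// mulr_suml -big_split/= mulr_sumr.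
Qed.

Variable v : vert G -> R -> I -> R.
Hypothesis v_bound : forall x t i, 0 <= t -> `|v x t i| <= C * expR (growth b kappa * t).
Hypothesis v_well : forall x t i, x \in well G -> v x t i = 0.
Hypothesis c_well : forall x t i, x \in well G -> c x t i = 0.
Hypothesis v_int : forall e t i, 0 <= t -> exp1.-integrable `[0, t]
  (EFin \o (fun s => \sum_j K e s i j * v (tgt e) (t - s) j)).
Hypothesis v_first_jump : forall x t i, x \notin well G -> 0 <= t ->
  v x t i = expR (- t) * c x t i + \sum_e jump_prob x e *
    (\int[exp1]_(s in `[0, t]) (\sum_j K e s i j * v (tgt e) (t - s) j))%R.

(** Both v and U_(N+1) satisfy a first-jump equation.  The difference of the
    terms without jump has the weight a_N of the ends of the edges, and the
    integral terms have it by the induction hypothesis; the average of these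
    weights over the edges is a_(N+1), and [growth_identity] restores the
    factor C e^(g t). *)
Lemma partial_value_error N x t i : 0 <= t ->
  `|v x t i - partial_value N x t i| <= survive N x * (C * expR (growth b kappa * t)).
Proof.
elim: N x t i => [|N IH] x t i t0.
  by rewrite survive0 mul1r /partial_value big_ord0 subr0; exact: v_bound.
rewrite surviveS; case: ifPn => xW.
  by rewrite v_well// partial_value_well ?c_well// subrr normr0 mul0r.
have [iU ->] := partial_valueS N i xW t0.
set g := growth b kappa; pose err e s :=
  \sum_j K e s i j * (v (tgt e) (t - s) j - partial_value N (tgt e) (t - s) j).
have errE e : err e = fun s =>
    (\sum_j K e s i j * v (tgt e) (t - s) j) -
    \sum_j K e s i j * partial_value N (tgt e) (t - s) j.
  by apply/funext => s; rewrite -sumrB; apply: eq_bigr => j _; rewrite mulrBr.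
have ierr e : exp1.-integrable `[0, t] (EFin \o err e).
  rewrite errE; have := integrableB _ (v_int e i t0) (iU e); apply.
  exact: measurable_itv.
have -> : v x t i - \sum_e jump_prob x e *
    (absorbed N (tgt e) * (expR (- t) * c x t i) + (\int[exp1]_(s in `[0, t])
       (\sum_j K e s i j * partial_value N (tgt e) (t - s) j))%R) =
    \sum_e jump_prob x e * (survive N (tgt e) * (expR (- t) * c x t i) +
      (\int[exp1]_(s in `[0, t]) err e s)%R).
  have -> : v x t i = \sum_e jump_prob x e * (expR (- t) * c x t i) +
      \sum_e jump_prob x e * (\int[exp1]_(s in `[0, t])
        (\sum_j K e s i j * v (tgt e) (t - s) j))%R.
    by rewrite -mulr_suml sum_jump_prob// mul1r v_first_jump.
  rewrite -big_split/= -sumrB; apply: eq_bigr => e _ /=.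
  by rewrite errE RintegralB//; [rewrite /survive; ring|exact: v_int].
apply: (le_trans (ler_norm_sum _ _ _)); rewrite mulr_suml ler_sum// => e _.
rewrite normrM ger0_norm ?jump_prob_ge0// -mulrA ler_wpM2l ?jump_prob_ge0//.
apply: (le_trans (ler_normD _ _)).
have [iY YE] := growth_identity b kappa (survive N (tgt e) * C) t0.
have -> : survive N (tgt e) * (C * expR (g * t)) =
    survive N (tgt e) * (expR (- t) * (C * expR (b * t))) +
    (survive N (tgt e) * C * expR (g * t) -
       expR (- t) * (survive N (tgt e) * C * expR (b * t))) by ring.
rewrite lerD//.
  rewrite normrM ger0_norm ?survive_ge0// ler_wpM2l ?survive_ge0//.
  by rewrite normrM ger0_norm ?expR_ge0// ler_wpM2l ?expR_ge0// c_bound.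
rewrite -YE; apply: (le_trans (le_normr_Rintegral _ (ierr e))) => //.
apply: le_Rintegral => //; first exact: integrable_norm.
move=> s; rewrite /= in_itv/= => /andP[s0 st].
apply: K_bound => // j; rewrite -mulrA; apply: IH; by rewrite subr_ge0.
Qed.

Lemma cvg_partial_value x t i : 0 <= t ->
  partial_value N x t i @[N --> \oo] --> v x t i.
Proof.
move=> t0; apply/cvgrPdist_le => eps eps0.
have : survive N x * (C * expR (growth b kappa * t)) @[N --> \oo] -->
    0 * (C * expR (growth b kappa * t)) by apply: cvgMl; exact: cvg_survive.
rewrite mul0r => /cvgrPdist_le /(_ _ eps0); apply: filterS => N.
rewrite sub0r normrN => /(le_trans _); apply.
by apply: le_trans (ler_norm _); exact: partial_value_error.
Qed.

End Convergence.

(** * Integration against the law of the walk *)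

Section WalkLawIntegral.
Context {R : realType} {G : wgraph R}.
Local Notation exp1 := (@exp1 R).
Implicit Types (x : vert G).

Definition positive_times n : set (n.-tuple R) := [set ts | all (fun s => 0 < s) ts].

Lemma measurable_positive_times n : measurable (@positive_times n).
Proof.
rewrite (_ : @positive_times n =
    \bigcap_(i in [set: 'I_n]) ((@tnth n R)^~ i @^-1` `]0, +oo[)); last first.
  apply/seteqP; split=> ts /=.
    by move=> /all_tnthP ts0 i _ /=; rewrite in_itv/= andbT.
  by move=> ts0; apply/all_tnthP => i; have := ts0 i I; rewrite /= in_itv/= andbT.
apply: fin_bigcap_measurable => // i _.
by rewrite -[X in measurable X]setTI; exact: (@measurable_tnth _ R n i).
Qed.

Lemma exp1_le0 : exp1 [set s | ~~ (0 < s)] = 0%E.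
Proof.
rewrite (_ : [set s | _] = [set` `]-oo, 0]]); last first.
  by apply/seteqP; split=> s /=; rewrite in_itv/= leNgt.
rewrite /exp1 /exponential_prob -integral_itv_bndo_bndc; last first.
  by apply/measurable_funTS/measurable_EFinP; exact: measurable_exponential_pdf.
apply: integral0_eq => s; rewrite /= in_itv/= => s0.
by rewrite lt0_exponential_pdf.
Qed.

(** The paths carry positive holding times, while the exponential law lives on
    the whole line: the difference is this null set. *)
Lemma exp1_tuple_positive n : exp1_tuple R n (~` @positive_times n) = 0%E.
Proof.
have mC k : measurable (~` @positive_times k).
  by apply: measurableC; exact: measurable_positive_times.
have mlt : measurable_fun setT (fun s : measurableTypeR R => 0 < s).
  by apply: measurable_fun_ltr => //; exact: measurable_cst.
have muE k : exp1_tuple R k (~` @positive_times k) =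
    (\int[exp1_tuple R k]_ts (\1_(~` @positive_times k) ts)%:E)%E.
  by rewrite integral_indic ?setIT//; exact: mC.
elim: n => [|n IH].
  rewrite (_ : ~` _ = set0) ?measure0//.
  by rewrite -subset0 => ts; apply; rewrite /positive_times/= [ts]tuple0.
rewrite muE ge0_integral_exp1_tupleS//; last first.
  by apply/measurable_EFinP; apply: measurable_indic; exact: mC.
rewrite (_ : (fun s => _) = (fun s => (\1_[set s | ~~ (0 < s)] s)%:E)); last first.
  apply/funext => s; rewrite [in RHS]indicE.
  have [s0|s0] := boolP (0 < s).
    rewrite memNset/=; last by rewrite /= s0.
    transitivity (exp1_tuple R n (~` @positive_times n)); last exact: IH.
    rewrite muE.
    apply: eq_integral => ts _; rewrite !indicE; congr (_%:R%:E).
    by congr nat_of_bool; apply/idP/idP; rewrite !inE /positive_times /= s0.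
  rewrite mem_set//=; transitivity (\int[exp1_tuple R n]_ts (cst 1 ts))%E.
    apply: eq_integral => ts _; rewrite indicE mem_set//.
    by rewrite /positive_times/= (negbTE s0).
  by rewrite integral_cst// mul1e [LHS]probability_setT.
have mS : @measurable _ (measurableTypeR R) [set s | ~~ (0 < s)].
  rewrite -[X in measurable X]setTI.
  rewrite (_ : [set s | _] = (fun s => 0 < s) @^-1` [set false]).
    exact: mlt.
  by apply/seteqP; split=> s /=; case: (0 < s).
rewrite integral_indic ?setIT//; exact: exp1_le0.
Qed.

(** The path with edges es, holding times ts and an infinite last holding time.
    The default path is taken if es is not a walk from x or if some time is
    not positive. *)
Definition timed_path x n (es : n.-tuple (edge G)) (ts : n.-tuple R) : cpath R G :=
  insubd (cpath0 R G) (mkraw x es (ts, +oo%E)).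

Lemma is_cpath_mkraw x n (es : n.-tuple (edge G)) (tau : n.-tuple R * \bar R) :
  is_cpath (mkraw x es tau) =
  [&& walk x es, all (fun s => 0 < s) tau.1 & (0 < tau.2)%E].
Proof.
rewrite /is_cpath /edges /times /steps /origin /= -/unzip1 -/unzip2.
by rewrite unzip1_zip ?unzip2_zip ?size_tuple.
Qed.

Lemma timed_pathK x n (es : n.-tuple (edge G)) ts : walk x es -> positive_times ts ->
  cpath_val (timed_path x es ts) = mkraw x es (ts, +oo%E).
Proof.
move=> wes ts0; rewrite /timed_path.
have ok : is_cpath (mkraw x es (ts, +oo%E)) by rewrite is_cpath_mkraw wes ts0 /= lt0y.
exact: (insubdK (cpath0 R G) ok).
Qed.

(** Positivity of the holding times is exactly what distinguishes a slice of
    the space of paths from a preimage by [timed_path]. *)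
Lemma slice_timed_path x n (es : n.-tuple (edge G)) A : walk x es ->
  [set ts | slice x es A (ts, +oo%E)] = @positive_times n `&` (timed_path x es @^-1` A).
Proof.
move=> wes; apply/seteqP; split=> ts /=.
  move=> [g Ag gE]; have := cpathP g; rewrite gE is_cpath_mkraw => /and3P[_ ts0 _].
  split => //; rewrite (_ : timed_path x es ts = g)//; apply: val_inj => /=.
  by rewrite timed_pathK.
by move=> [ts0 Ag]; exists (timed_path x es ts) => //; rewrite timed_pathK.
Qed.

Lemma measurable_slice_infinite x n (es : n.-tuple (edge G)) (A : set (cpath R G)) : measurable A ->
  measurable [set ts | slice x es A (ts, +oo%E)].
Proof.
move=> mA; rewrite -[X in measurable X]setTI.
by apply: (@measurable_fun_pair _ _ _ _ _ _ id (cst +oo%E)) => //; exact: mA.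
Qed.

Lemma measurable_timed_path x n (es : n.-tuple (edge G)) : walk x es ->
  measurable_fun setT (timed_path x es).
Proof.
move=> wes _ A mA; rewrite setTI.
rewrite -(setTI (_ @^-1` _)) -(setUv (@positive_times n)) setIUl.
apply: measurableU.
  by rewrite -slice_timed_path//; exact: measurable_slice_infinite.
have -> : ~` @positive_times n `&` timed_path x es @^-1` A =
    ~` @positive_times n `&` (fun=> A (cpath0 R G)).
  apply/seteqP; split=> ts /= [ts0]; rewrite /timed_path /insubd insubN// ;
  by rewrite is_cpath_mkraw /= (negbTE (introN idP ts0)) andbF.
apply: measurableI; first by apply: measurableC; exact: measurable_positive_times.
have [a|na] := pselect (A (cpath0 R G)).
  by rewrite (_ : (fun=> _) = setT)//; apply/seteqP; split.
by rewrite (_ : (fun=> _) = set0)//; apply/seteqP; split.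
Qed.

(** The law of the paths with given edges is thus an image measure, and
    integrals against it are integrals over the holding times. *)
Lemma timed_law_pushforward x n (es : n.-tuple (edge G)) A : walk x es ->
  measurable A ->
  timed_law x es A = pushforward (exp1_tuple R n) (timed_path x es) A.
Proof.
move=> wes mA; rewrite /timed_law slice_timed_path// /pushforward.
have mB : measurable (timed_path x es @^-1` A).
  by rewrite -[X in measurable X]setTI; exact: measurable_timed_path.
have mP := @measurable_positive_times n.
rewrite -[in RHS](setTI (_ @^-1` _)) -(setUv (@positive_times n)) setIUl measureU.
- rewrite [X in (_ + X)%E](_ : _ = 0%E) ?adde0//.
  apply: subset_measure0 (exp1_tuple_positive n) => //.
  by apply: measurableI => //; exact: measurableC.
  exact: measurableC.
- exact: measurableI.
- by apply: measurableI => //; exact: measurableC.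
- by rewrite setIACA setICr set0I.
Qed.

Lemma ge0_integral_timed_law x n (es : n.-tuple (edge G)) (f : cpath R G -> \bar R) :
  walk x es -> measurable_fun setT f -> (forall g, 0 <= f g)%E ->
  (\int[timed_law x es]_g f g = \int[exp1_tuple R n]_ts f (timed_path x es ts))%E.
Proof.
move=> wes mf f0.
rewrite -(@ge0_integral_pushforward _ _ _ _ _ _ (measurable_timed_path wes) _ setT f)//.
apply: eq_measure_integral => [|? A mA _]; first exact: measurable_timed_path.
exact: timed_law_pushforward.
Qed.

Lemma walk_prob_nonwalk x (es : seq (edge G)) : ~~ walk x es -> walk_prob x es = 0.
Proof.
elim: es x => //= e es IH x; case: ifP => // _; rewrite negb_and /jump_prob.
by case: eqP => //= _ => [/IH->|_]; rewrite ?mulr0 ?mul0r.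
Qed.

(** The law of the walk is rewritten as a countable sum of finite sums of
    measures, the edge sequences of a given length being enumerated, in order
    to integrate term by term. *)
Let scaled x n (es : n.-tuple (edge G)) : {measure set (cpath R G) -> \bar R} :=
  mscale (NngNum (walk_prob_ge0 x es)) (timed_law x es).

Let layer x n (i : nat) : {measure set (cpath R G) -> \bar R} :=
  if insub i is Some o then scaled x (enum_val (o : 'I_#|{: n.-tuple (edge G)}|))
  else mzero.

Let level x n : {measure set (cpath R G) -> \bar R} :=
  msum (layer x n) #|{: n.-tuple (edge G)}|.

Let walk_law_mseries x : walk_law x = mseries (level x) 0.
Proof.
apply/funext => A; rewrite /walk_law /mseries; apply: eq_eseriesr => n _.
rewrite /= /msum (reindex (@enum_val _ {: n.-tuple (edge G)})) /=; last first.
  exact/onW_bij/enum_val_bij.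
by apply: eq_bigr => i _; rewrite /layer valK.
Qed.

Lemma ge0_integral_walk_law x (f : cpath R G -> \bar R) :
  measurable_fun setT f -> (forall g, 0 <= f g)%E ->
  (\int[walk_law x]_g f g = \sum_(n <oo) \sum_(es : n.-tuple (edge G))
     (walk_prob x es)%:E * \int[exp1_tuple R n]_ts f (timed_path x es ts))%E.
Proof.
move=> mf f0.
transitivity (\int[mseries (level x) 0]_g f g)%E.
  apply: eq_measure_integral => A _ _; exact: (congr1 (fun m => m A) (walk_law_mseries x)).
rewrite ge0_integral_measure_series//; apply: eq_eseriesr => n _.
rewrite ge0_integral_measure_sum//.
rewrite [RHS](reindex (@enum_val _ {: n.-tuple (edge G)})) /=; last first.
  exact/onW_bij/enum_val_bij.
apply: eq_bigr => i _; rewrite /layer valK ge0_integral_mscale//=.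
have [wes|nwes] := boolP (walk x (enum_val i)).
  by rewrite ge0_integral_timed_law.
by rewrite walk_prob_nonwalk// !mul0e.
Qed.

End WalkLawIntegral.

Section WalkLawLimit.
Context {R : realType} {G : wgraph R}.
Implicit Types (x : vert G).

(** The sigma-field on paths is defined by slices, so that measurability can be
    tested on the holding times, one discrete path at a time. *)
Lemma measurable_fun_cpath (f : cpath R G -> R)
    (F : vert G -> forall n, n.-tuple (edge G) -> n.-tuple R * \bar R -> R) :
  (forall x n es, measurable_fun setT (F x n es)) ->
  (forall g x n es tau, cpath_val g = mkraw x es tau -> f g = F x n es tau) ->
  measurable_fun setT f.
Proof.
move=> mF fF _ Y mY; rewrite setTI; suff: cpath_measurable (f @^-1` Y) by [].
move=> x n es.
have -> : slice x es (f @^-1` Y) = slice x es setT `&` F x n es @^-1` Y.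
  apply/seteqP; split=> tau /= [g].
    by move=> Yg gE; split; [exists g|rewrite /= -(fF _ _ _ _ _ gE)].
    by case: g => g _ gE Yt; exists g => //=; rewrite (fF _ _ _ _ _ gE).
apply: measurableI; first exact: measurable_sliceT.
by rewrite -[X in measurable X]setTI; exact: mF.
Qed.

Section Limit.
Variables (x : vert G) (f : cpath R G -> R) (M : R).
Variable (J : forall n, seq (edge G) -> n.-tuple R -> R).
Hypothesis f_meas : measurable_fun setT f.
Hypothesis M_ge0 : 0 <= M.
Hypothesis J_meas : forall n (es : n.-tuple (edge G)), measurable_fun setT (J (n := n) es).
Hypothesis J_bound : forall n (es : n.-tuple (edge G)),
  (\int[exp1_tuple R n]_ts `|J es ts|%:E <= M%:E)%E.
Hypothesis fJ : forall n (es : n.-tuple (edge G)) ts, walk x es ->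
  positive_times ts -> f (timed_path x es ts) = J es ts.

(** Applied below to the norm and to the positive and negative parts of f; the
    uniform bound M on the integrals over the holding times gives the same
    bound on the whole integral, the total mass being at most 1. *)
Lemma ge0_walk_law_limit (phi : R -> R) : measurable_fun setT phi ->
  (forall a, 0 <= phi a <= `|a|) ->
  (\int[walk_law x]_g (phi (f g))%:E <= M%:E)%E /\
  (\sum_(n < N) \sum_(es : n.-tuple (edge G)) walk_prob x es *
      \int[exp1_tuple R n]_ts phi (J es ts))%R @[N --> \oo] -->
  (\int[walk_law x]_g phi (f g))%R.
Proof.
move=> mphi phi_bd.
have phi0 a : 0 <= phi a by case/andP: (phi_bd a).
have Jfin n (es : n.-tuple (edge G)) :
    (0 <= \int[exp1_tuple R n]_ts (phi (J es ts))%:E <= M%:E)%E.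
  rewrite integral_ge0/= => [|ts _]; last by rewrite lee_fin.
  apply: le_trans (J_bound es); apply: ge0_le_integral => //.
  - by move=> ts _; rewrite lee_fin.
  - by apply/measurable_EFinP; exact: (measurableT_comp mphi (J_meas es)).
  - by apply/measurable_EFinP; apply: measurableT_comp => //; exact: J_meas.
  - by move=> ts _; rewrite lee_fin; case/andP: (phi_bd (J es ts)).
pose r n : R := \sum_(es : n.-tuple (edge G)) walk_prob x es *
  (\int[exp1_tuple R n]_ts phi (J es ts))%R.
have RJ n (es : n.-tuple (edge G)) :
    (\int[exp1_tuple R n]_ts (phi (J es ts))%:E)%E =
    ((\int[exp1_tuple R n]_ts phi (J es ts))%R)%:E.
  rewrite fineK// ge0_fin_numE; last by case/andP: (Jfin n es).
  by case/andP: (Jfin n es) => _ /le_lt_trans; apply; rewrite ltry.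
have r0 n : 0 <= r n.
  apply: sumr_ge0 => es _; rewrite mulr_ge0 ?walk_prob_ge0//.
  exact: Rintegral_ge0.
have intE : (\int[walk_law x]_g (phi (f g))%:E = \sum_(n <oo) (r n)%:E)%E.
  rewrite ge0_integral_walk_law; last 2 first.
  - by apply/measurable_EFinP; exact: (measurableT_comp mphi f_meas).
  - by move=> g; rewrite lee_fin.
  apply: eq_eseriesr => n _; rewrite /r -sumEFin; apply: eq_bigr => es _.
  have [wes|nwes] := boolP (walk x es); last by rewrite walk_prob_nonwalk// mul0r mul0e.
  rewrite EFinM -RJ; congr (_ * _)%E; apply: ae_eq_integral => //.
  - apply/measurable_EFinP.
    exact: (measurableT_comp mphi (measurableT_comp f_meas (measurable_timed_path wes))).
  - by apply/measurable_EFinP; exact: (measurableT_comp mphi (J_meas es)).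
  exists (~` @positive_times R n); split.
  - by apply: measurableC; exact: measurable_positive_times.
  - exact: exp1_tuple_positive.
  - by move=> ts /= + ts0; apply => _; rewrite fJ.
have cr : (\sum_(0 <= n < N) (r n)%:E)%E @[N --> \oo] -->
    (\int[walk_law x]_g (phi (f g))%:E)%E.
  by rewrite intE; apply: is_cvg_nneseries => n _ _; rewrite lee_fin.
have leM : (\int[walk_law x]_g (phi (f g))%:E <= M%:E)%E.
  rewrite -(cvg_lim _ cr)//; apply: lime_le; first by apply/cvg_ex; eexists; exact: cr.
  apply: nearW => N; rewrite sumEFin lee_fin big_mkord.
  apply: (@le_trans _ _ (absorbed N x * M)).
    rewrite /absorbed mulr_suml; apply: ler_sum => n _; rewrite mulr_suml.
    apply: ler_sum => es _; rewrite ler_wpM2l ?walk_prob_ge0//.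
    by rewrite -lee_fin -RJ; case/andP: (Jfin n es).
  rewrite ler_piMl//; have := survive_ge0 N x; rewrite /survive; lra.
split => //.
rewrite (_ : (fun N => _) = fine \o (fun N => \sum_(0 <= n < N) (r n)%:E)%E).
  apply: fine_cvg; rewrite /Rintegral fineK//.
  rewrite ge0_fin_numE; first by apply: le_lt_trans leM _; rewrite ltry.
  by apply: integral_ge0 => g _; rewrite lee_fin.
by apply/funext => N /=; rewrite sumEFin/= big_mkord.
Qed.

(** The integral over all paths is the limit of the contributions of the
    trajectories of fewer than N steps. *)
Lemma walk_law_limit :
  (walk_law x).-integrable setT (EFin \o f) /\
  (\sum_(n < N) \sum_(es : n.-tuple (edge G)) walk_prob x es *
      \int[exp1_tuple R n]_ts J es ts)%R @[N --> \oo] -->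
  (\int[walk_law x]_g f g)%R.
Proof.
pose p (a : R) := Order.max a 0; pose m (a : R) := Order.max (- a) 0.
have mp : measurable_fun setT p by exact: measurable_maxr.
have mm : measurable_fun setT m.
  apply: measurable_maxr => //; exact: measurable_oppr.
have pb a : 0 <= p a <= `|a|.
  by rewrite /p le_max lexx orbT ge_max ler_norm normr_ge0.
have mb a : 0 <= m a <= `|a|.
  by rewrite /m le_max lexx orbT ge_max normr_ge0 -normrN ler_norm.
have pm a : a = p a - m a.
  by rewrite /p /m; case: (lerP a 0) => a0; case: (lerP (- a) 0) => a0'; lra.
have mnorm : measurable_fun setT (fun a : R => `|a|).
  by apply: continuous_measurable_fun; exact: norm_continuous.
have [Mn _] := ge0_walk_law_limit mnorm
  (fun a => introT andP (conj (normr_ge0 a) (lexx _))).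
have int_f : (walk_law x).-integrable setT (EFin \o f).
  apply/integrableP; split; first exact/measurable_EFinP.
  by apply: le_lt_trans Mn _; rewrite ltry.
have int_J n (es : n.-tuple (edge G)) :
    (exp1_tuple R n).-integrable setT (EFin \o J (n := n) es).
  apply/integrableP; split; first by apply/measurable_EFinP; exact: J_meas.
  by apply: le_lt_trans (J_bound es) _; rewrite ltry.
have int_comp d (T : measurableType d) (mu : {measure set T -> \bar R}) (h : T -> R) (phi : R -> R) :
    measurable_fun setT phi -> (forall a, 0 <= phi a <= `|a|) ->
    mu.-integrable setT (EFin \o h) -> mu.-integrable setT (EFin \o (phi \o h)).
  move=> mphi phib ih; apply: (le_integrable measurableT _ _ ih).
    have := measurable_int _ ih => /measurable_EFinP mh.
    by apply/measurable_EFinP; exact: measurableT_comp.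
  move=> y _ /=; rewrite lee_fin; have /andP[a0 a1] := phib (h y).
  by rewrite ger0_norm.
have split_int d (T : measurableType d) (mu : {measure set T -> \bar R}) (h : T -> R) :
    mu.-integrable setT (EFin \o h) ->
    (\int[mu]_y h y = \int[mu]_y p (h y) - \int[mu]_y m (h y))%R.
  move=> ih; rewrite -RintegralB//; [|exact: int_comp mp pb ih|exact: int_comp mm mb ih].
  by apply: eq_Rintegral => y _; exact: pm.
split => //; rewrite split_int//.
rewrite (_ : (fun N => _) = fun N =>
    (\sum_(n < N) \sum_(es : n.-tuple (edge G)) walk_prob x es *
      (\int[exp1_tuple R n]_ts p (J es ts))%R) -
    (\sum_(n < N) \sum_(es : n.-tuple (edge G)) walk_prob x es *
      (\int[exp1_tuple R n]_ts m (J es ts))%R)).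
  by apply: cvgB; [have [] := ge0_walk_law_limit mp pb|have [] := ge0_walk_law_limit mm mb].
apply/funext => N; rewrite -sumrB; apply: eq_bigr => n _; rewrite -sumrB.
by apply: eq_bigr => es _; rewrite -mulrBr split_int.
Qed.

End Limit.
End WalkLawLimit.

(** * Exponentials of finite kernels *)

Section KernelExponential.
Context {R : realType} {Y : finType}.
Implicit Types (a : Y -> Y -> R) (p q : Y).

(** The n-th power of the matrix a, for a finite index type that need not be
    of the form {0, ..., n - 1}: below it is a set of coordinates of a fibre, or
    of pairs of a vertex and a coordinate. *)
Fixpoint kpow a n p q : R :=
  if n is n'.+1 then \sum_l kpow a n' p l * a l q else (p == q)%:R.

(** The matrix e^(t a), entry by entry. *)
Definition kexp a t p q : R := egf (fun n => kpow a n p q) t.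

Lemma sum_delta (u : Y -> R) p : \sum_q (p == q)%:R * u q = u p.
Proof.
rewrite (bigD1 p)//= eqxx mul1r big1 ?addr0// => q /negbTE qp.
by rewrite eq_sym qp mul0r.
Qed.

Lemma sum_deltar (u : Y -> R) p : \sum_q u q * (q == p)%:R = u p.
Proof. by under eq_bigr do rewrite mulrC eq_sym; exact: sum_delta. Qed.

Lemma kpowSl a n p q : kpow a n.+1 p q = \sum_l a p l * kpow a n l q.
Proof.
elim: n q => [|n IH] q.
  by rewrite /= sum_delta sum_deltar.
rewrite -[LHS]/(\sum_l kpow a n.+1 p l * a l q); under eq_bigr do rewrite IH mulr_suml.
rewrite exchange_big; apply: eq_bigr => l _ /=; rewrite mulr_sumr.
by apply: eq_bigr => m _; rewrite mulrA.
Qed.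

(** The operator norm of a for the sup norm is at most B. *)
Definition kernel_bound a B :=
  forall (u : Y -> R) y, (forall q, `|u q| <= y) -> forall p, `|\sum_q a p q * u q| <= B * y.

Lemma kernel_bound_sum a B : (forall p, \sum_q `|a p q| <= B) -> kernel_bound a B.
Proof.
move=> aB u y uy p; have y0 : 0 <= y by apply: le_trans (uy p).
apply: le_trans (ler_norm_sum _ _ _) _.
apply: le_trans (ler_wpM2r y0 (aB p)); rewrite mulr_suml; apply: ler_sum => q _.
by rewrite normrM ler_wpM2l.
Qed.

Lemma ex_kernel_bound a : exists2 B, 0 <= B & kernel_bound a B.
Proof.
exists (\sum_p \sum_q `|a p q|); first by do 2 apply: sumr_ge0 => ? _.
apply: kernel_bound_sum => p; rewrite [leRHS](bigD1 p)//= lerDl.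
by do 2 apply: sumr_ge0 => ? _.
Qed.

Section Bounded.
Variables (a : Y -> Y -> R) (B : R).
Hypothesis B_ge0 : 0 <= B.
Hypothesis aB : kernel_bound a B.

Lemma kpow_bound n u y : (forall q, `|u q| <= y) ->
  forall p, `|\sum_q u q * kpow a n p q| <= y * B ^+ n.
Proof.
elim: n u y => [|n IH] u y uy p.
  by rewrite expr0 mulr1 /=; under eq_bigr do rewrite mulrC; rewrite sum_delta.
rewrite /= (_ : \sum_q _ = \sum_l (\sum_q a l q * u q) * kpow a n p l).
  by rewrite exprS mulrA (mulrC y); apply: IH => q; exact: aB.
under eq_bigr do rewrite mulr_sumr.
rewrite exchange_big; apply: eq_bigr => l _ /=; rewrite mulr_suml.
by apply: eq_bigr => q _; ring.
Qed.

Lemma kpow_geombound p q : geombound (fun n => kpow a n p q) 1 B.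
Proof.
split=> // n; rewrite -(sum_delta (fun q => kpow a n p q) q).
by apply: kpow_bound => l; case: eqP; rewrite ?normr1 ?normr0.
Qed.

Lemma kexp_apply (u : Y -> R) t p :
  egf (fun n => \sum_q u q * kpow a n p q) t = \sum_q kexp a t p q * u q.
Proof.
rewrite (egf_sum u t (kpow_geombound p)).
by apply: eq_bigr => q _; rewrite mulrC.
Qed.

Lemma kexp_bound u y t p : (forall q, `|u q| <= y) ->
  `|\sum_q kexp a t p q * u q| <= y * expR (B * `|t|).
Proof.
move=> uy; rewrite -kexp_apply; apply: egf_bound; split=> // n.
exact: kpow_bound.
Qed.

Lemma kexp0 p q : kexp a 0 p q = (p == q)%:R.
Proof. by rewrite /kexp egf0. Qed.

Lemma is_derive_kexpr t p q :
  is_derive t (1 : R) (fun t => kexp a t p q) (\sum_l kexp a t p l * a l q).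
Proof.
have := is_derive_egf t (kpow_geombound p q); rewrite /=.
rewrite (_ : (fun n => \sum_l _) = (fun n => \sum_l a l q * kpow a n p l)).
  rewrite (egf_sum (fun l => a l q) t (kpow_geombound p)).
  by under eq_bigr do rewrite mulrC.
by apply/funext => n; apply: eq_bigr => l _; rewrite mulrC.
Qed.

Lemma is_derive_kexpl t p q :
  is_derive t (1 : R) (fun t => kexp a t p q) (\sum_l a p l * kexp a t l q).
Proof.
have := is_derive_egf t (kpow_geombound p q).
rewrite (_ : (fun n => kpow a n.+1 _ _) = (fun n => \sum_l a p l * kpow a n l q)).
  by rewrite (egf_sum (a p) t (fun l => kpow_geombound l q)).
by apply/funext => n; exact: kpowSl.
Qed.

Lemma continuous_kexp p q : continuous (fun t => kexp a t p q).
Proof. exact: continuous_egf (kpow_geombound p q). Qed.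

(** The partial sums of the exponential series of an abstract operator T, read
    in coordinates rho in which T acts as t a; it serves for operators on a
    fibre as well as on sections. *)
Lemma kexp_series (S : Type) (T : S -> S) (rho : S -> Y -> R) (t : R) s p :
  (forall s p, rho (T s) p = t * \sum_q a p q * rho s q) ->
  \sum_(j < n) (j`!%:R)^-1 * rho (iter j T s) p @[n --> \oo] -->
  \sum_q kexp a t p q * rho s q.
Proof.
move=> Ta.
have iterE n : rho (iter n T s) = fun p => t ^+ n * \sum_q rho s q * kpow a n p q.
  elim: n => [|n IH]; apply/funext => p'.
    by rewrite expr0 mul1r /=; under eq_bigr do rewrite mulrC; rewrite sum_delta.
  rewrite iterS Ta IH exprS -mulrA; congr (_ * _).
  under eq_bigr do rewrite mulrCA.
  rewrite -mulr_sumr; congr (_ * _).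
  under eq_bigr do rewrite mulr_sumr.
  rewrite exchange_big; apply: eq_bigr => q _ /=; rewrite -/(kpow a n.+1 p' q) kpowSl mulr_sumr.
  by apply: eq_bigr => l _; ring.
rewrite -kexp_apply /egf.
have gb : geombound (fun n => \sum_q rho s q * kpow a n p q) (\sum_q `|rho s q|) B.
  split=> // n; apply: kpow_bound => q.
  by rewrite (bigD1 q)//= lerDl sumr_ge0.
rewrite (_ : (fun n => \sum_(j < n) _) =
    pseries (fun n => (n`!%:R)^-1 * \sum_q rho s q * kpow a n p q) t).
  exact: is_cvg_egf gb.
apply/funext => n; rewrite /pseries /series /= big_mkord.
by apply: eq_bigr => j _; rewrite iterE; ring.
Qed.

End Bounded.
End KernelExponential.

(** * The formula in real coordinates *)

Lemma is_derive_fsum (R : realType) (J : finType) (g : J -> R -> R) (dg : J -> R) t :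
  (forall q, is_derive t (1 : R) (g q) (dg q)) ->
  is_derive t (1 : R) (fun t => \sum_q g q t) (\sum_q dg q).
Proof.
move=> H; rewrite -fct_sumE; elim/big_ind2 : _ => //; last by move=> *; exact: is_deriveD.
exact: is_derive_cst.
Qed.

Lemma is_derive_mulr (R : realType) (g h : R -> R) (dg dh : R) t :
  is_derive t (1 : R) g dg -> is_derive t (1 : R) h dh ->
  is_derive t (1 : R) (fun t => g t * h t) (dg * h t + g t * dh).
Proof.
move=> Hg Hh; have := is_deriveM Hg Hh; rewrite addrC /GRing.scale/=.
by rewrite (mulrC (h t)).
Qed.

Section RealFeynmanKac.
Context {R : realType} {G : wgraph R} {I : finType}.
Local Notation exp1 := (@exp1 R).
Implicit Types (x : vert G) (e : edge G) (i j : I).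
Variables (kH : vert G -> I -> I -> R) (M : edge G -> I -> I -> R) (f : vert G -> I -> R).
Hypothesis f_well : forall x i, x \in well G -> f x i = 0.

(** The kernel of the Laplacian on coordinates of sections, given kernels kH x
    of the potential and M e of the transport from the target of e back to its
    source. *)
Definition lap_kernel (p q : vert G * I) : R :=
  if p.1 \in well G then 0 else
  (p == q)%:R
  - \sum_e jump_prob p.1 e * ((tgt e \notin well G) && (tgt e == q.1))%:R * M e p.2 q.2
  + (p.1 == q.1)%:R * kH p.1 p.2 q.2.

Lemma sum_vertex (a : vert G -> I -> R) x :
  \sum_(q : vert G * I) (x == q.1)%:R * a q.1 q.2 = \sum_j a x j.
Proof.
rewrite -(pair_bigA _ (fun y j => (x == y)%:R * a y j))/=.
under eq_bigr do rewrite -mulr_sumr.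
exact: sum_delta.
Qed.

Lemma lap_kernelE (u : vert G * I -> R) x i : x \notin well G ->
  \sum_q lap_kernel (x, i) q * u q =
  u (x, i) - \sum_e jump_prob x e * (tgt e \notin well G)%:R * \sum_j M e i j * u (tgt e, j)
  + \sum_j kH x i j * u (x, j).
Proof.
move=> xW; rewrite /lap_kernel /= (negbTE xW).
under eq_bigr do rewrite mulrDl mulrBl.
rewrite big_split sumrB /= sum_delta; congr (_ - _ + _).
  under eq_bigr do rewrite mulr_suml.
  rewrite exchange_big; apply: eq_bigr => e _ /=.
  rewrite -(sum_vertex (fun y j => M e i j * u (y, j))) mulr_sumr.
  apply: eq_bigr => -[y j] _ /=.
  by case: (tgt e \notin well G); case: (tgt e == y) => /=; ring.
rewrite -(sum_vertex (fun y j => kH y i j * u (y, j))).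
apply: eq_bigr => -[y j] _ /=; case: eqP => [->|_] /=; ring.
Qed.

(** The coordinates of e^(-t Delta) f. *)
Definition heat_coord x t i : R :=
  \sum_q kexp (fun p q => - lap_kernel p q) t (x, i) q * f q.1 q.2.

Definition damp_kernel x t i j : R := kexp (fun i j => - kH x i j) t i j.

(** The coordinates of e^(-t H_x) f(x). *)
Definition stay_coord x t i : R := \sum_l damp_kernel x t i l * f x l.

(** The kernel of e^(-s H) h_(e^-1), where H is taken at the source of e. *)
Definition jump_kernel e s i j : R := \sum_l damp_kernel (src e) s i l * M e l j.

Let kabs (a : I -> I -> R) : R := \sum_i \sum_j `|a i j|.

Let kabs_ge0 a : 0 <= kabs a.
Proof. by apply: sumr_ge0 => i _; exact: sumr_ge0. Qed.

Let kabs_bound a : kernel_bound a (kabs a).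
Proof.
apply: kernel_bound_sum => i; rewrite /kabs [leRHS](bigD1 i)//= lerDl.
by apply: sumr_ge0 => j _; exact: sumr_ge0.
Qed.

Let hB : R := \sum_x kabs (kH x).
Let mB : R := \sum_e kabs (M e).
Let B : R := 1 + mB + hB.
Let kappa : R := 1 + mB.
Let C : R := \sum_x \sum_i `|f x i|.

Let hB_ge0 : 0 <= hB. Proof. exact: sumr_ge0. Qed.
Let mB_ge0 : 0 <= mB. Proof. exact: sumr_ge0. Qed.
Let C_ge0 : 0 <= C. Proof. by apply: sumr_ge0 => x _; exact: sumr_ge0. Qed.
Let B_ge0 : 0 <= B. Proof. by rewrite /B; have := hB_ge0; have := mB_ge0; lra. Qed.
Let kappa_ge1 : 1 <= kappa. Proof. by rewrite lerDl. Qed.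

Let f_le x i : `|f x i| <= C.
Proof.
rewrite /C (bigD1 x)//= (bigD1 i)//= -addrA lerDl addr_ge0//.
  exact: sumr_ge0.
by apply: sumr_ge0 => y _; exact: sumr_ge0.
Qed.

Let kH_bound x u y : (forall j, `|u j| <= y) -> forall i, `|\sum_j kH x i j * u j| <= hB * y.
Proof.
move=> uy i; have y0 : 0 <= y by apply: le_trans (uy i).
apply: le_trans ((@kabs_bound _ : kernel_bound _ _) _ _ uy i) _; rewrite ler_wpM2r//.
by rewrite /hB (bigD1 x)//= lerDl sumr_ge0.
Qed.

Let M_bound e u y : (forall j, `|u j| <= y) -> forall i, `|\sum_j M e i j * u j| <= mB * y.
Proof.
move=> uy i; have y0 : 0 <= y by apply: le_trans (uy i).
apply: le_trans ((@kabs_bound _ : kernel_bound _ _) _ _ uy i) _; rewrite ler_wpM2r//.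
by rewrite /mB (bigD1 e)//= lerDl sumr_ge0.
Qed.

Let damp_kernel_bounded x : kernel_bound (fun i j => - kH x i j) B.
Proof.
move=> u y uy i; have y0 : 0 <= y by apply: le_trans (uy i).
under eq_bigr do rewrite mulNr.
rewrite sumrN normrN; apply: le_trans (kH_bound x uy i) _.
by rewrite ler_wpM2r// /B; have := mB_ge0; lra.
Qed.

Let lap_kernel_bounded : kernel_bound (fun p q => - lap_kernel p q) B.
Proof.
move=> u y uy [x i]; have y0 : 0 <= y by apply: le_trans (uy (x, i)).
under eq_bigr do rewrite mulNr.
rewrite sumrN normrN; have [xW|xW] := boolP (x \in well G).
  rewrite big1 ?normr0 ?mulr_ge0// => q _.
  by rewrite /lap_kernel /= xW mul0r.
rewrite lap_kernelE// (le_trans (ler_normD _ _))// /B !mulrDl mul1r lerD//; last first.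
  exact: (kH_bound x (fun j => uy (x, j))).
rewrite (le_trans (ler_normB _ _))// lerD//.
apply: le_trans (ler_norm_sum _ _ _) _.
rewrite -[leRHS]mul1r -[X in X * (mB * y)](sum_jump_prob xW) mulr_suml; apply: ler_sum => e _.
rewrite normrM normrM ger0_norm ?jump_prob_ge0// -mulrA ler_wpM2l ?jump_prob_ge0//.
rewrite -[leRHS]mul1r ler_pM//.
  by case: (tgt e \in well G); rewrite ?normr1 ?normr0.
exact: (M_bound e (fun j => uy (tgt e, j))).
Qed.

Let heat_bound x t i : 0 <= t -> `|heat_coord x t i| <= C * expR (growth B kappa * t).
Proof.
move=> t0; apply: le_trans (kexp_bound B_ge0 lap_kernel_bounded t (x, i)
  (u := fun q => f q.1 q.2) (y := C) _) _.
  by move=> q; exact: f_le.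
rewrite ger0_norm// ler_wpM2l// ler_expR ler_wpM2r// /growth.
by have := kappa_ge1; lra.
Qed.

(** The rows of the kernel at the vertices of the well vanish, hence only the
    term of order 0 of the exponential series remains there. *)
Lemma heat_coord_well x t i : x \in well G -> heat_coord x t i = 0.
Proof.
move=> xW; rewrite /heat_coord -(kexp_apply B_ge0 lap_kernel_bounded).
apply/eqP; rewrite -normr_le0.
apply: le_trans (egf_bound (C := 0) (b := 0) t _) _; last by rewrite mul0r.
split => // n; rewrite mul0r; case: n => [|n].
  under eq_bigr do rewrite mulrC.
  by rewrite /= sum_delta f_well// normr0.
rewrite big1 ?normr0// => q _; rewrite kpowSl big1 ?mulr0// => l _.
by rewrite /lap_kernel /= xW oppr0 mul0r.
Qed.

Lemma heat_coord0 x i : heat_coord x 0 i = f x i.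
Proof.
rewrite /heat_coord; under eq_bigr do rewrite kexp0.
by rewrite sum_delta.
Qed.

Lemma stay_coord_well x t i : x \in well G -> stay_coord x t i = 0.
Proof. by move=> xW; rewrite /stay_coord big1// => l _; rewrite f_well// mulr0. Qed.

Let is_derive_heat x t i : x \notin well G ->
  is_derive t (1 : R) (fun t => heat_coord x t i)
    (- (heat_coord x t i
     - \sum_e jump_prob x e * (tgt e \notin well G)%:R *
         \sum_j M e i j * heat_coord (tgt e) t j
     + \sum_j kH x i j * heat_coord x t j)).
Proof.
move=> xW; pose u q := heat_coord q.1 t q.2.
have -> : heat_coord x t i
     - \sum_e jump_prob x e * (tgt e \notin well G)%:R *
         \sum_j M e i j * heat_coord (tgt e) t j
     + \sum_j kH x i j * heat_coord x t j = \sum_q lap_kernel (x, i) q * u q.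
  by rewrite lap_kernelE.
have -> : - (\sum_q lap_kernel (x, i) q * u q) =
    \sum_q (\sum_l - lap_kernel (x, i) l * kexp (fun p q => - lap_kernel p q) t l q) * f q.1 q.2.
  under [RHS]eq_bigr do rewrite mulr_suml.
  rewrite exchange_big -sumrN; apply: eq_bigr => l _ /=.
  rewrite -mulNr /u /heat_coord mulr_sumr; apply: eq_bigr => q _.
  by rewrite -surjective_pairing mulrA.
apply: is_derive_fsum => q.
have H := is_derive_mulr (is_derive_kexpl B_ge0 lap_kernel_bounded t (x, i) q)
  (is_derive_cst (f q.1 q.2) t 1).
by rewrite mulr0 addr0 in H.
Qed.

Let is_derive_heat_well x t i : x \in well G ->
  is_derive t (1 : R) (fun t => heat_coord x t i) 0.
Proof.
move=> xW; rewrite (_ : (fun t => _) = cst 0); first exact: is_derive_cst.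
by apply/funext => s; exact: heat_coord_well.
Qed.

Let continuous_heat x i : continuous (fun t => heat_coord x t i).
Proof.
move=> t; apply/differentiable_continuous/derivable1_diffP.
have [xW|xW] := boolP (x \in well G); first by case: (is_derive_heat_well t i xW).
by case: (is_derive_heat t i xW).
Qed.

Let continuous_damp x i j : continuous (fun t => damp_kernel x t i j).
Proof. exact: continuous_kexp B_ge0 (damp_kernel_bounded x) i j. Qed.

Let continuous_fsum (J : finType) (g : J -> R -> R) :
  (forall q, continuous (g q)) -> continuous (fun t => \sum_q g q t).
Proof.
move=> H; apply: continuous_big; first exact: add_continuous.
by move=> q _; exact: H.
Qed.

Lemma continuous_jump e i j : continuous (fun s => jump_kernel e s i j).
Proof.
by apply: continuous_fsum => l t; apply: cvgMl; exact: continuous_damp.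
Qed.

Lemma continuous_stay x i : continuous (fun s => stay_coord x s i).
Proof.
by apply: continuous_fsum => l t; apply: cvgMl; exact: continuous_damp.
Qed.

Let stay_bound x t i : 0 <= t -> `|stay_coord x t i| <= C * expR (B * t).
Proof.
move=> t0; rewrite -[in leRHS](ger0_norm t0).
by apply: (kexp_bound B_ge0 (damp_kernel_bounded x)) => l; exact: f_le.
Qed.

Let jump_bound e s u y : 0 <= s -> (forall j, `|u j| <= y) ->
  forall i, `|\sum_j jump_kernel e s i j * u j| <= kappa * expR (B * s) * y.
Proof.
move=> s0 uy i; have y0 : 0 <= y by apply: le_trans (uy i).
rewrite (_ : \sum_j _ = \sum_l damp_kernel (src e) s i l * \sum_j M e l j * u j); last first.
  under eq_bigr do rewrite mulr_suml.
  rewrite exchange_big; apply: eq_bigr => l _ /=; rewrite mulr_sumr.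
  by apply: eq_bigr => j _; rewrite mulrA.
apply: le_trans (kexp_bound B_ge0 (damp_kernel_bounded (src e)) s i (y := mB * y) _) _.
  by move=> l; exact: M_bound.
rewrite ger0_norm// mulrAC ler_wpM2r ?expR_ge0//.
by rewrite ler_wpM2r// /kappa lerDr.
Qed.

Let continuous_source e t i :
  continuous (fun s => \sum_j jump_kernel e s i j * heat_coord (tgt e) (t - s) j).
Proof.
apply: continuous_fsum => j s; apply: cvgM; first exact: continuous_jump.
apply: (@continuous_comp _ _ _ (fun s => t - s) (fun s => heat_coord (tgt e) s j));
  last exact: continuous_heat.
by apply: cvgB => //; exact: cvg_cst.
Qed.

(** Duhamel's formula: the diagonal part 1 + H_x of the Laplacian at x is
    compensated by the factor e^-s e^(-s H_x) in w(s), so that the derivative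
    of w contains the hopping terms only.  The edges that lead to the well are
    dropped by the Laplacian; on the right-hand side they contribute 0. *)
Lemma heat_first_jump x t i : x \notin well G -> 0 <= t ->
  heat_coord x t i = expR (- t) * stay_coord x t i + \sum_e jump_prob x e *
    (\int[exp1]_(s in `[0, t])
       (\sum_j jump_kernel e s i j * heat_coord (tgt e) (t - s) j))%R.
Proof.
move=> xW t0.
pose phi s := \sum_e jump_prob x e *
  \sum_j jump_kernel e s i j * heat_coord (tgt e) (t - s) j.
pose w s := expR (- s) * \sum_l damp_kernel x s i l * heat_coord x (t - s) l.
have cphi : continuous phi.
  by apply: continuous_fsum => e s; apply: cvgMr; exact: continuous_source.
have dw s : is_derive s (1 : R) w (- (phi s * expR (- s))).
  pose dv l := heat_coord x (t - s) l
     - \sum_e jump_prob x e * (tgt e \notin well G)%:R *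
         \sum_j M e l j * heat_coord (tgt e) (t - s) j
     + \sum_j kH x l j * heat_coord x (t - s) j.
  have dexp : is_derive s (1 : R) (fun s => expR (- s)) (- expR (- s)).
    by rewrite -mulrN1; exact: is_derive1_comp.
  have dheat l : is_derive s (1 : R) (fun s => heat_coord x (t - s) l) (dv l).
    have sub : is_derive s (1 : R) (fun s => t - s) (-1).
      by rewrite -[X in is_derive _ _ _ X]add0r; exact: is_deriveB.
    have := @is_derive1_comp R (fun s => heat_coord x s l) (fun s => t - s)
      s _ _ (is_derive_heat (t - s) l xW) sub.
    by rewrite mulrN1 opprK.
  have dsum := is_derive_fsum (fun l => is_derive_mulr
    (is_derive_kexpr B_ge0 (damp_kernel_bounded x) s i l) (dheat l)).
  have D := is_derive_mulr dexp dsum.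
  apply: (is_derive_eq D).
  (* X comes from the factor e^-s and is compensated by the identity part of the
     Laplacian, Y from the potential, and Z collects the hopping terms. *)
  pose X := \sum_l damp_kernel x s i l * heat_coord x (t - s) l.
  pose Y := \sum_m damp_kernel x s i m * \sum_l kH x m l * heat_coord x (t - s) l.
  pose Z l := \sum_e jump_prob x e * (tgt e \notin well G)%:R *
         \sum_j M e l j * heat_coord (tgt e) (t - s) j.
  have -> : phi s = \sum_l damp_kernel x s i l * Z l.
    rewrite /phi /Z; under [RHS]eq_bigr do rewrite mulr_sumr.
    rewrite [RHS]exchange_big; apply: eq_bigr => e _ /=.
    under [RHS]eq_bigr do rewrite -mulrA mulrCA.
    rewrite -mulr_sumr /jump_prob; case: eqP => [<-|_]; last by rewrite !mul0r.
    congr (_ * _).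
    have [tW|tW] /= := boolP (tgt e \in well G).
      rewrite big1 => [|j _]; last by rewrite heat_coord_well// mulr0.
      by rewrite big1// => l _; rewrite mul0r mulr0.
    rewrite /jump_kernel; under eq_bigr do rewrite mulr_suml.
    rewrite exchange_big; apply: eq_bigr => l _ /=; rewrite mul1r mulr_sumr.
    by apply: eq_bigr => j _; rewrite mulrA.
  have -> : \sum_l ((\sum_m kexp (fun i j => - kH x i j) s i m * - kH x m l) *
      heat_coord x (t - s) l +
      kexp (fun i j => - kH x i j) s i l * dv l) =
      - Y + (X - \sum_l damp_kernel x s i l * Z l + Y).
    rewrite big_split /=; congr (_ + _).
      under eq_bigr do rewrite mulr_suml.
      rewrite exchange_big -sumrN; apply: eq_bigr => m _ /=.
      by rewrite mulr_sumr -sumrN; apply: eq_bigr => l _; rewrite /damp_kernel; ring.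
    by rewrite -sumrB -big_split; apply: eq_bigr => l _ /=; rewrite /dv /Z /damp_kernel; ring.
  by rewrite [X0 in _ * X0 + _](_ : _ = X)//; ring.
have -> : heat_coord x t i = expR (- t) * stay_coord x t i + (w 0 - w t).
  have -> : w 0 = heat_coord x t i.
    rewrite /w oppr0 expR0 mul1r addr0 -[RHS](sum_delta (heat_coord x t)).
    by apply: eq_bigr => l _; rewrite /damp_kernel kexp0.
  rewrite /w subrr; under [X in _ - _ * X]eq_bigr do rewrite heat_coord0.
  by rewrite /stay_coord; ring.
congr (_ + _); rewrite -(exp1_FTC t0 cphi dw) Rintegral_sum//; last first.
  move=> e; apply: integrable_mulrl => //.
  by apply: exp1_integrable_continuous; exact: continuous_source.
apply: eq_bigr => e _; rewrite RintegralZl//.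
by apply: exp1_integrable_continuous; exact: continuous_source.
Qed.

(** The main formula for a function F on paths of which only the values on the
    paths charged by the law of the walk are prescribed. *)
Theorem real_feynman_kac x t i (F : cpath R G -> R) : 0 <= t ->
  measurable_fun setT F ->
  (forall n (es : n.-tuple (edge G)) ts, walk x es -> positive_times ts ->
    F (timed_path x es ts) = path_value stay_coord jump_kernel x es ts t i) ->
  (walk_law x).-integrable setT (EFin \o F) /\
  (\int[walk_law x]_g F g)%R = heat_coord x t i.
Proof.
move=> t0 mF Fpath.
have c_meas y j : measurable_fun setT (fun t => stay_coord y t j).
  by apply: continuous_measurable_fun; exact: continuous_stay.
have K_meas e j l : measurable_fun setT (fun s => jump_kernel e s j l).
  by apply: continuous_measurable_fun; exact: continuous_jump.
have [iF cF] := @walk_law_limit R G x F (C * expR (growth B kappa * t))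
  (fun n es ts => path_value stay_coord jump_kernel x es ts t i) mF
  (mulr_ge0 C_ge0 (expR_ge0 _))
  (fun n es => measurable_path_value_times c_meas K_meas es x t i)
  (fun n es => (integrable_path_value kappa_ge1 C_ge0 c_meas K_meas
     stay_bound jump_bound x i (size_tuple es) t0).2) Fpath.
split => //; apply/(cvg_unique _ cF) => //.
apply: (cvg_partial_value kappa_ge1 C_ge0 c_meas K_meas stay_bound jump_bound
  heat_bound heat_coord_well stay_coord_well _ heat_first_jump t0) => e s j s0.
by apply: exp1_integrable_continuous; exact: continuous_source.
Qed.

End RealFeynmanKac.

(** * Real and imaginary parts *)

Section Scalars.
Context {R : realType} {k : scalar_kind}.
Local Notation K := (scalar_field k R).
Implicit Types (z : K) (a b : R).

Lemma reK_additive : {morph @reK k R : z z' / z + z'}.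
Proof. by case: k => //= -[a b] [a' b']. Qed.

Lemma imK_additive : {morph @imK k R : z z' / z + z'}.
Proof. by case: k => [z z'|[a b] [a' b']] //=; rewrite addr0. Qed.

Lemma ofRD : {morph @ofR k R : a b / a + b}.
Proof. by case: k => //= a b; rewrite /ofR /=; apply/eqP; rewrite eq_complex /= addr0 !eqxx. Qed.

Lemma ofRM : {morph @ofR k R : a b / a * b}.
Proof.
by case: k => //= a b; rewrite /ofR /=; apply/eqP; rewrite eq_complex /= !mul0r mulr0 subr0 addr0 !eqxx.
Qed.

Lemma ofR1 : ofR k 1 = 1 :> scalar_field k R.
Proof. by case: k. Qed.

Lemma ofR_nat n : ofR k n%:R = n%:R :> scalar_field k R.
Proof.
elim: n => [|n IH]; first by case: k.
by rewrite !mulrS ofRD ofR1 IH.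
Qed.

Lemma ofR_natV n : ofR k n%:R^-1 = n%:R^-1 :> scalar_field k R.
Proof.
case: n => [|n]; first by rewrite !invr0; case: k.
have n0 : (n.+1%:R : scalar_field k R) != 0 by rewrite pnatr_eq0.
by apply: (mulIf n0); rewrite mulVf// -ofR_nat -ofRM mulVf ?ofR1// pnatr_eq0.
Qed.

Lemma reK_ofRM a z : reK (ofR k a * z) = a * reK z.
Proof. by case: k z => // -[b c] /=; rewrite mul0r subr0. Qed.

Lemma imK_ofRM a z : imK (ofR k a * z) = a * imK z.
Proof. by case: k z => [z|[b c]] /=; rewrite ?mulr0// mul0r addr0. Qed.

(** The imaginary unit, or 0 in the real case. *)
Definition iK : K := mkK k 0 1.

Lemma scalar_decomp z : z = ofR k (reK z) + ofR k (imK z) * iK.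
Proof.
rewrite /iK; case: k z => [z|[b c]]; first by rewrite /ofR /= mulr0 addr0.
by rewrite /ofR /=; apply/eqP; rewrite eq_complex /= !mul0r !mulr0 !mulr1 subr0 !addr0 add0r !eqxx.
Qed.

Lemma reK_mkK a b : reK (mkK k a b) = a.
Proof. by case: k. Qed.

(** Limits in R or C are taken for the topology of the norm of the field; they
    are computed on the real and imaginary parts. *)
Lemma lim_scalar (z : nat -> K) a b :
  reK (z n) @[n --> \oo] --> a -> imK (z n) @[n --> \oo] --> b ->
  reK (lim (z n @[n --> \oo])) = a /\ imK (lim (z n @[n --> \oo])) = b.
Proof.
case: k z => z /=.
  move=> za zb; split; first exact: cvg_lim.
  by apply: (cvg_unique _ _ zb) => //; exact: cvg_cst.
move=> za zb; suff -> : lim (z n @[n --> \oo]) = (a +i* b)%C by [].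
apply: cvg_lim; first exact: norm_hausdorff.
apply/cvgrPdist_lt => e e0.
(* A positive element of the complex field is real. *)
have [er e0r] : e = (complex.Re e)%:C%C /\ 0 < complex.Re e.
  by case: e e0 => er ei; rewrite ltcE /= => /andP[/eqP -> ?].
have e2 : 0 < complex.Re e / 2 by rewrite divr_gt0.
move/cvgrPdist_lt : za => /(_ _ e2) za; move/cvgrPdist_lt : zb => /(_ _ e2) zb.
near=> n.
have zan : `|a - complex.Re (z n)| < complex.Re e / 2 by near: n.
have zbn : `|b - complex.Im (z n)| < complex.Re e / 2 by near: n.
rewrite er; apply: (@le_lt_trans _ _ (`|a - complex.Re (z n)| + `|b - complex.Im (z n)|)%:C%C); last first.
  by rewrite ltcR; lra.
rewrite normc_def lecR.
case: (z n) zan zbn => c d /= _ _.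
rewrite -[leRHS]ger0_norm ?addr_ge0// -sqrtr_sqr; apply: ler_wsqrtr.
rewrite [leRHS]sqrrD !real_normK ?num_real// lerD2r lerDl.
by rewrite mulrn_wge0// mulr_ge0.
Unshelve. all: by end_near. Qed.

End Scalars.

(** * Real coordinates of the fibres *)

Section Coordinates.
Context {R : realType} {k : scalar_kind} {r : nat}.
Local Notation K := (scalar_field k R).
Local Notation I := ('I_r * bool)%type.
Implicit Types (A : hspace k R r).

Definition partK (b : bool) (z : K) : R := if b then imK z else reK z.

Lemma partKD b : {morph partK b : z z' / z + z'}.
Proof. by case: b; [exact: imK_additive|exact: reK_additive]. Qed.

Lemma partK_ofRM b a z : partK b (ofR k a * z) = a * partK b z.
Proof. by case: b; [exact: imK_ofRM|exact: reK_ofRM]. Qed.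

Definition basis_index A (l : 'I_r) : 'I_(\dim {: A}) := cast_ord (esym (hdim A)) l.

(** The real coordinates: the boolean selects the imaginary part.  In the real
    case half of the coordinates are 0, which allows one index type for both
    kinds of scalars. *)
Definition rcoord A (v : A) (p : I) : R := partK p.2 (vcoord (basis_index A p.1) v).

(** A family that spans the fibre over R (with zero vectors in the real case,
    so that it is not a basis in general). *)
Definition rbasis A (p : I) : A :=
  (if p.2 then iK else 1) *: (vbasis {: A})`_(basis_index A p.1).

Lemma rcoordD A (u v : A) p : rcoord (u + v) p = rcoord u p + rcoord v p.
Proof. by rewrite /rcoord /vcoord linearD partKD. Qed.

Lemma rcoordZ A a (v : A) p : rcoord (ofR k a *: v) p = a * rcoord v p.
Proof. by rewrite /rcoord /vcoord linearZ partK_ofRM. Qed.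

Lemma partK0 b : partK b 0 = 0.
Proof. by have := partK_ofRM b 0 0; rewrite mulr0 mul0r. Qed.

Lemma rcoord0 A p : rcoord (0 : A) p = 0.
Proof. by rewrite /rcoord /vcoord linear0 partK0. Qed.

Lemma rcoord_sum A (J : Type) (s : seq J) (P : pred J) (g : J -> A) p :
  rcoord (\sum_(j <- s | P j) g j) p = \sum_(j <- s | P j) rcoord (g j) p.
Proof. by elim/big_ind2 : _ => [|u a v b <- <-|//]; rewrite ?rcoord0 ?rcoordD. Qed.

Lemma rcoordN A (v : A) p : rcoord (- v) p = - rcoord v p.
Proof. by apply/eqP; rewrite -addr_eq0 -rcoordD addNr rcoord0. Qed.

Lemma sum_basis_index A (V : nmodType) (g : 'I_(\dim {: A}) -> V) :
  \sum_i g i = \sum_(l < r) g (basis_index A l).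
Proof.
rewrite (reindex (basis_index A))//; exists (cast_ord (hdim A)) => i _.
  exact: cast_ordKV.
exact: cast_ordK.
Qed.

Lemma rcoord_decomp A (v : A) : v = \sum_p ofR k (rcoord v p) *: rbasis A p.
Proof.
rewrite [LHS](coord_vbasis (memvf v)) sum_basis_index.
rewrite -(pair_bigA _ (fun l b => ofR k (rcoord v (l, b)) *: rbasis A (l, b)))/=.
apply: eq_bigr => l _; rewrite big_bool /rbasis /rcoord /= scale1r scalerA -scalerDl.
by congr (_ *: _); rewrite [LHS]scalar_decomp addrC.
Qed.

Lemma rcoord_inj A (u v : A) : (forall p, rcoord u p = rcoord v p) -> u = v.
Proof.
by move=> uv; rewrite [u]rcoord_decomp [v]rcoord_decomp; apply: eq_bigr => p _; rewrite uv.
Qed.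

Definition real_linear A A' (L : A -> A') :=
  (forall u v, L (u + v) = L u + L v) /\ (forall a v, L (ofR k a *: v) = ofR k a *: L v).

(** A matrix of L with respect to [rbasis]. *)
Definition rkernel A A' (L : A -> A') (p q : I) : R := rcoord (L (rbasis A q)) p.

Lemma rcoord_linear A A' (L : A -> A') v p : real_linear L ->
  rcoord (L v) p = \sum_q rkernel L p q * rcoord v q.
Proof.
move=> [LD LZ]; rewrite {1}[v]rcoord_decomp.
have L0 : L 0 = 0 by apply: (addrI (L 0)); rewrite -LD !addr0.
rewrite (big_morph L LD L0) rcoord_sum; apply: eq_bigr => q _.
by rewrite LZ rcoordZ mulrC.
Qed.

Lemma vcoord_sum A (c : 'I_(\dim {: A}) -> K) i :
  vcoord i (\sum_(j < \dim {: A}) c j *: (vbasis {: A})`_j) = c i.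
Proof. exact: coord_sum_free (basis_free (vbasisP _)). Qed.

Lemma rcoord_vlim A (u : nat -> A) (l : I -> R) :
  (forall p, rcoord (u n) p @[n --> \oo] --> l p) ->
  forall p, rcoord (vlim u) p = l p.
Proof.
move=> ul [j b]; rewrite /rcoord /vlim vcoord_sum /=.
have [] := lim_scalar (ul (j, false)) (ul (j, true)).
by case: b.
Qed.

Lemma imK_mkK_Rintegral d (T : measurableType d) (mu : {measure set T -> \bar R})
    (z : T -> K) a :
  imK (mkK k a (\int[mu]_w imK (z w))%R) = (\int[mu]_w imK (z w))%R.
Proof. by case: k z => // z; rewrite [RHS]Rintegral_cst ?mul0r. Qed.

Lemma rcoord_vintegral d (T : measurableType d) (mu : {measure set T -> \bar R}) A
    (g : T -> A) p :
  rcoord (vintegral mu g) p = (\int[mu]_w rcoord (g w) p)%R.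
Proof.
rewrite /rcoord /vintegral vcoord_sum /Kintegral; case: p => j [] /=; last by rewrite reK_mkK.
exact: imK_mkK_Rintegral.
Qed.

Lemma rcoord_vintegrable d (T : measurableType d) (mu : {measure set T -> \bar R}) A
    (g : T -> A) :
  (forall p, mu.-integrable setT (EFin \o (fun w => rcoord (g w) p))) -> vintegrable mu g.
Proof.
move=> ig i; have -> : i = basis_index A (cast_ord (hdim A) i) by rewrite /basis_index cast_ordK.
by split; [exact: (ig (_, false))|exact: (ig (_, true))].
Qed.

End Coordinates.

(** * Transport, potential and Laplacian in coordinates *)

Section Transport.
Context {R : realType} {k : scalar_kind} {r : nat} {G : wgraph R} {F : bundle k R r G}.
Implicit Types x y z : vert G.

Lemma transp_id x (v : F x) : transp x v = v.
Proof. by rewrite /transp; case: eqP => // p; rewrite (eq_irrelevance p erefl). Qed.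

Lemma transp_neq x y (v : F x) : x != y -> transp y v = 0.
Proof. by rewrite /transp; case: eqP. Qed.

Lemma transp_section (f : section F) x y : x = y -> transp y (f x) = f y.
Proof. by move=> <-; exact: transp_id. Qed.

Lemma transp_transp x y z (v : F x) : x = y -> transp z (transp y v) = transp z v.
Proof. by move=> <-; rewrite transp_id. Qed.

Lemma transp_real_linear x y : real_linear (@transp k R r G F x y).
Proof.
have [<-|xy] := eqVneq x y.
  by split=> *; rewrite !transp_id.
by split=> *; rewrite !transp_neq// ?addr0 ?scaler0.
Qed.

End Transport.

Section Operators.
Context {R : realType} {k : scalar_kind} {r : nat}.
Local Notation I := ('I_r * bool)%type.

Lemma rcoord_expv (A : hspace k R r) (T : 'End(A)) (s : R) (v : A) p :
  rcoord (expv (ofR k (- s) *: T) v) p =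
  \sum_q kexp (fun p q => - rkernel T p q) s p q * rcoord v q.
Proof.
have lT : real_linear T by split=> *; rewrite ?linearD ?linearZ.
rewrite /expv; apply: (rcoord_vlim (l := fun p =>
  \sum_q kexp (fun p q => - rkernel T p q) s p q * rcoord v q)) => {}p.
under eq_cvg do rewrite rcoord_sum.
have [B B0 HB] := ex_kernel_bound (fun p q => - rkernel T p q).
rewrite (_ : (fun n => _) = (fun n => \sum_(j < n) (j`!%:R)^-1 *
  rcoord (iter j (ofR k (- s) *: T) v) p)); last first.
  by apply/funext => n; apply: eq_bigr => j _; rewrite -ofR_natV rcoordZ.
apply: (kexp_series B0 HB (S := A) (T := ofR k (- s) *: T)
  (rho := @rcoord R k r A) (t := s)) => w p'.
rewrite scale_lfunE rcoordZ (rcoord_linear _ _ lT) mulr_sumr mulr_sumr.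
by apply: eq_bigr => q _; ring.
Qed.

Context {G : wgraph R} {F : bundle k R r G}.
Variables (h : connection F) (H : potential F).
Implicit Types x y : vert G.

(** The operator h_(e^-1), with values in the fibre at the source of e. *)
Definition back_transport (e : edge G) (v : F (tgt e)) : F (src e) :=
  transp (src e) (conn_edge h (transp (src (einv e)) v)).

Lemma back_transport_real_linear e : real_linear (@back_transport e).
Proof.
have [tD tZ] := transp_real_linear (F := F) (tgt (einv e)) (src e).
have [sD sZ] := transp_real_linear (F := F) (tgt e) (src (einv e)).
split=> [u v|a v]; rewrite /back_transport /conn_edge.
  by rewrite sD !linearD tD.
by rewrite sZ !linearZ tZ.
Qed.

Definition pot_kernel x : I -> I -> R := rkernel (H x).
Definition edge_kernel e : I -> I -> R := rkernel (@back_transport e).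
Definition section_coord (f : section F) (q : vert G * I) : R := rcoord (f q.1) q.2.

Lemma pot_real_linear x : real_linear (H x).
Proof. by split=> *; rewrite ?linearD ?linearZ. Qed.

Lemma rcoord_lap (g : section F) x p :
  rcoord (lap h H g x) p =
  \sum_q lap_kernel pot_kernel edge_kernel (x, p) q * section_coord g q.
Proof.
rewrite /lap /lap_conn; case: ifPn => xW.
  rewrite add0r pot_well// lfunE/= rcoord0 big1// => q _.
  by rewrite /lap_kernel /= xW mul0r.
rewrite lap_kernelE// !rcoordD rcoordN rcoord_sum.
rewrite (rcoord_linear _ _ (pot_real_linear x)); congr (_ - _ + _).
rewrite big_mkcond /=; apply: eq_bigr => e _.
rewrite {2}/jump_prob; case: eqP => [ex|_] /=; last by rewrite !mul0r.
case: (tgt e \notin well G); rewrite ?mulr0 ?mul0r// mulr1.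
rewrite /jump_prob ex eqxx rcoordZ; congr (_ * _).
transitivity (rcoord (back_transport (g (tgt e))) p).
  by rewrite /back_transport; case: _ / ex.
by rewrite (rcoord_linear _ _ (back_transport_real_linear e)).
Qed.

Lemma rcoord_heat (f : section F) t x p :
  rcoord (heat h H t f x) p =
  heat_coord pot_kernel edge_kernel (fun x p => rcoord (f x) p) x t p.
Proof.
rewrite /heat /exp_section; apply: (rcoord_vlim (l := fun p =>
  heat_coord pot_kernel edge_kernel (fun x p => rcoord (f x) p) x t p)) => {}p.
under eq_cvg do rewrite rcoord_sum.
pose a := lap_kernel pot_kernel edge_kernel.
have [B B0 HB] := ex_kernel_bound (fun p q => - a p q).
rewrite (_ : (fun n => _) = (fun n => \sum_(j < n) (j`!%:R)^-1 *
  section_coord (iter j (fun g x => ofR k (- t) *: lap h H g x) f) (x, p))); last first.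
  by apply/funext => n; apply: eq_bigr => j _; rewrite -ofR_natV rcoordZ.
apply: (kexp_series B0 HB (S := section F) (T := fun g x => ofR k (- t) *: lap h H g x)
  (rho := section_coord) (t := t)) => w [y q].
rewrite /section_coord /= rcoordZ rcoord_lap mulr_sumr mulr_sumr.
by apply: eq_bigr => l _; rewrite /section_coord /a; ring.
Qed.

End Operators.

(** * Holonomy along a reversed truncated path *)

Section PathHolonomy.
Context {R : realType} {k : scalar_kind} {r : nat} {G : wgraph R} {F : bundle k R r G}.
Variables (h : connection F) (H : potential F) (f : section F).
Implicit Types (x y : vert G) (s : seq (R * edge G)).

Lemma transp_damp x y tau (v : F x) : x = y ->
  transp y (damp H tau v) = damp H tau (transp y v).
Proof. by move=> <-; rewrite !transp_id. Qed.

(** The holonomy is defined by recursion from the start of the path, whereas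
    the reversal of a path puts its first step at the end: the last step has to
    be split off.  The transport to x makes the two sides have the same type. *)
Lemma hol_from_rcons x y s p tau (v : F y) : tgt p.2 = x ->
  transp x (@hol_from k R r G F h H y (rcons s p) tau v) =
  damp H tau (transp x (conn_edge h (transp (src p.2)
    (@hol_from k R r G F h H y s p.1%:E v)))).
Proof.
move=> px; elim: s y v => [|q s IH] y v /=; last exact: IH.
exact: transp_damp.
Qed.

Lemma zip_rconsl (S T : Type) (A : seq S) a (B : seq T) :
  size A = size B -> zip (rcons A a) B = zip A B.
Proof. by elim: A B => [|x A IH] [|y B]//= [/IH->]. Qed.

Definition raw_path (x : vert G) s (theta : \bar R) : rawpath R G := ((x, s), theta).

(** Reversing a path turns its first holding time into the last one, and the
    last holding time of the reversed tail into that of an intermediate vertex. *)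
Lemma reverse_cons x tau e s (theta : R) :
  let g := reverse (raw_path (tgt e) s theta%:E) in
  reverse (raw_path x ((tau, e) :: s) theta%:E) =
  raw_path (origin g) (rcons (steps g) (fine (last_time g), einv e)) tau%:E.
Proof.
rewrite /= /reverse /raw_path /steps /times /edges /last_time /origin /endpoint /=.
congr (_, _, _).
set ts := rcons _ theta; set es := [seq einv _ | _ <- _].
have sz : size (rev ts) = (size (rev es)).+1.
  by rewrite !size_rev size_rcons !size_map.
rewrite /= !rev_cons.
have -> : rev ts = rcons (rev (behead ts)) (head 0 ts).
  by rewrite /ts; case: s {es sz ts} => [|[a b] s] //=; rewrite rev_cons.
have sz' : size (rev (behead ts)) = size (rev es).
  by rewrite size_rev size_behead -(size_rev ts) sz.
rewrite zip_rconsl ?size_rcons ?sz'// zip_rcons// zip_rconsl//.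
Qed.

(** The integrand, for a path that has already been truncated. *)
Definition back_hol x s (theta : R) : F x :=
  transp x (hol h H (reverse (raw_path x s theta%:E)) (f (endpoint (raw_path x s theta%:E)))).

Lemma endpoint_reverse x s (theta : R) : walk x [seq p.2 | p <- s] ->
  endpoint (reverse (raw_path x s theta%:E)) = x.
Proof.
case: s => [//|[tau e] s] /= /andP[/eqP ex _].
rewrite reverse_cons /endpoint /edges /steps /= !map_rcons last_rcons.
by rewrite /= tgt_einv.
Qed.

Lemma back_hol_nil x (theta : R) : back_hol x [::] theta = damp H theta%:E (f x).
Proof. exact: transp_id. Qed.

Lemma back_hol_cons x tau e s (theta : R) : src e = x -> walk (tgt e) [seq p.2 | p <- s] ->
  back_hol x ((tau, e) :: s) theta =
  damp H tau%:E (transp x (conn_edge h (transp (src (einv e)) (back_hol (tgt e) s theta)))).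
Proof.
move=> ex ws; rewrite /back_hol transp_transp; last exact: endpoint_reverse.
set y := endpoint (raw_path (tgt e) s theta%:E).
have rE := reverse_cons x tau e s theta.
have [stE ltE] := (congr1 (@steps R G) rE, congr1 (@last_time R G) rE).
(* The holonomies are exposed as [hol_from] at the common end point y, because
   the equations on the reversed paths cannot be rewritten in their types. *)
change (transp x (@hol_from k R r G F h H y (steps (reverse (raw_path x ((tau, e) :: s) theta%:E)))
  (last_time (reverse (raw_path x ((tau, e) :: s) theta%:E))) (f y)) =
  damp H tau%:E (transp x (conn_edge h (transp (src (einv e))
    (@hol_from k R r G F h H y (steps (reverse (raw_path (tgt e) s theta%:E)))
       (last_time (reverse (raw_path (tgt e) s theta%:E))) (f y)))))).
rewrite stE ltE hol_from_rcons//=.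
by rewrite tgt_einv.
Qed.

Lemma jump_time_cons x tau e s tn i :
  jump_time (raw_path x ((tau, e) :: s) tn) i.+1 = tau + jump_time (raw_path (tgt e) s tn) i.
Proof. by rewrite /jump_time big_nat_recl. Qed.

Lemma index_at_cons x tau e s tn t :
  index_at (raw_path x ((tau, e) :: s) tn) t =
  if t < tau then 0%N else (index_at (raw_path (tgt e) s tn) (t - tau)).+1.
Proof.
rewrite /index_at /steps /= jump_time_cons {1}/jump_time big_geq// addr0.
case: ifP => // _; rewrite -[1%N]addn0 iotaDl find_map; congr _.+1.
by apply: eq_find => i /=; rewrite add1n jump_time_cons ltrBlDl.
Qed.

Lemma truncate_nil x tn t : truncate (raw_path x [::] tn) t = raw_path x [::] t%:E.
Proof. by rewrite /truncate /jump_time /= big_geq// subr0. Qed.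

(** Truncation either stops before the first jump or continues along the tail,
    with the remaining time. *)
Lemma truncate_cons x tau e s tn t : truncate (raw_path x ((tau, e) :: s) tn) t =
  if t < tau then raw_path x [::] t%:E else
  let g := truncate (raw_path (tgt e) s tn) (t - tau) in
  raw_path x ((tau, e) :: steps g) (last_time g).
Proof.
rewrite {1}/truncate index_at_cons; case: ifP => _.
  by rewrite take0 /jump_time big_geq// subr0.
by rewrite jump_time_cons opprD addrA.
Qed.

(** The first-jump recursion in the fibres; [path_value] is its version in
    coordinates. *)
Fixpoint vector_path_value x s t : F x :=
  if s is (tau, e) :: s' then
    if 0 <= tau <= t then
      damp H tau%:E (transp x (conn_edge h
        (transp (src (einv e)) (vector_path_value (tgt e) s' (t - tau)))))
    else damp H t%:E (f x)
  else damp H t%:E (f x).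

Lemma walk_truncate x s tn t : walk x [seq p.2 | p <- s] ->
  walk x [seq p.2 | p <- steps (truncate (raw_path x s tn) t)].
Proof.
elim: s x t => [|[tau e] s IH] x t //= /andP[ex ws].
by rewrite truncate_cons; case: ifP => //= _; rewrite ex IH.
Qed.

Lemma back_hol_truncate x s tn t : walk x [seq p.2 | p <- s] ->
  all (fun a => 0 < a) [seq p.1 | p <- s] ->
  let g := truncate (raw_path x s tn) t in
  back_hol x (steps g) (fine (last_time g)) = vector_path_value x s t.
Proof.
elim: s x t => [|[tau e] s IH] x t.
  by move=> _ _ g; rewrite /g truncate_nil; exact: back_hol_nil.
move=> ws s0 g; rewrite {}/g truncate_cons.
have /andP[/eqP ex wes] := ws; have /andP[tau0 s0'] := s0.
rewrite [RHS]/= (ltW tau0) leNgt; case: ltP => ttau; first exact: back_hol_nil.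
rewrite -(IH (tgt e))//; apply: back_hol_cons => //; exact: walk_truncate.
Qed.

Definition raw_integrand x t (g : rawpath R G) : F x :=
  transp x (hol h H (reverse (truncate g t))
    (transp (endpoint (truncate g t)) (f (position g t)))).

Lemma position_truncate (g : rawpath R G) t : position g t = endpoint (truncate g t).
Proof. by rewrite /position /nth_vert /endpoint /edges /truncate /steps /origin /= !map_take. Qed.

Lemma raw_integrandE x s tn t : walk x [seq p.2 | p <- s] ->
  all (fun a => 0 < a) [seq p.1 | p <- s] ->
  raw_integrand x t (raw_path x s tn) = vector_path_value x s t.
Proof.
move=> ws s0; rewrite -(back_hol_truncate tn t ws s0) /raw_integrand /back_hol.
by rewrite transp_section// position_truncate.
Qed.

(** Paths that do not start at x have measure 0, but the integrand is also
    evaluated on them: it is the default value of the transport between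
    distinct vertices. *)
Lemma raw_integrand_neq x y s tn t : walk y [seq p.2 | p <- s] -> y != x ->
  raw_integrand x t (raw_path y s tn) = 0.
Proof.
move=> ws yx; apply: transp_neq.
rewrite [X in X != _](_ : _ = y)//.
exact: (endpoint_reverse _ (walk_truncate tn t ws)).
Qed.

Local Notation I := ('I_r * bool)%type.
Local Notation kH := (pot_kernel H).
Local Notation kM := (edge_kernel h).
Local Notation fc := (fun x p => rcoord (f x) p).

Lemma rcoord_damp x (tau : R) (v : F x) p :
  rcoord (damp H tau%:E v) p = \sum_q damp_kernel kH x tau p q * rcoord v q.
Proof. exact: rcoord_expv. Qed.

Lemma rcoord_vector_path_value x (es : seq (edge G)) (ts : seq R) t p : walk x es ->
  size ts = size es ->
  rcoord (vector_path_value x (zip ts es) t) p =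
  path_value (stay_coord kH fc) (jump_kernel kH kM) x es ts t p.
Proof.
elim: es ts x t p => [|e es IH] [|tau ts] //= x t p => [_ _|]; first exact: rcoord_damp.
move=> /andP[/eqP ex wes] [sz]; case: ifP => _; last exact: rcoord_damp.
rewrite rcoord_damp.
set w := vector_path_value _ _ _.
transitivity (\sum_l damp_kernel kH (src e) tau p l * rcoord (back_transport h w) l).
  by rewrite /back_transport; case: _ / ex.
transitivity (\sum_l \sum_q damp_kernel kH (src e) tau p l *
    (kM e l q * rcoord w q)).
  apply: eq_bigr => l _; rewrite -mulr_sumr; congr (_ * _).
  exact: rcoord_linear (back_transport_real_linear h e).
rewrite exchange_big; apply: eq_bigr => j _ /=; rewrite /jump_kernel mulr_suml.
by apply: eq_bigr => l _; rewrite mulrA -IH.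
Qed.

End PathHolonomy.

Theorem theorem3p1 (R : realType) (k : scalar_kind) (r : nat) (G : wgraph R)
    (F : bundle k R r G) (h : connection F) (H : potential F)
    (f : section F) (hf : section0 f)
    (x : vert G) (hx : x \notin well G) (t : R) (ht : 0 <= t) :
  let integrand := fun g : cpath R G =>
    transp x (hol h H (reverse (truncate g t))
                (transp (endpoint (truncate g t)) (f (position g t)))) in
  vintegrable (walk_law x) integrand /\
  heat h H t f x = vintegral (walk_law x) integrand.
Proof.
move=> integrand.
have integrandE g : integrand g = raw_integrand h H f x t (cpath_val g) by [].
pose stay := stay_coord (pot_kernel H) (fun x p => rcoord (f x) p).
pose jump := jump_kernel (pot_kernel H) (edge_kernel h).
have coordE (g : cpath R G) y n (es : n.-tuple (edge G)) tau p :
    cpath_val g = mkraw y es tau ->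
    rcoord (integrand g) p = if y == x then path_value stay jump x es tau.1 t p else 0.
  move=> gE; have := cpathP g; rewrite gE is_cpath_mkraw => /and3P[wes tau0 _].
  have es2 : [seq q.2 | q <- zip tau.1 es] = es.
    by rewrite -/unzip2 unzip2_zip// !size_tuple.
  have es1 : [seq q.1 | q <- zip tau.1 es] = tau.1.
    by rewrite -/unzip1 unzip1_zip// !size_tuple.
  rewrite integrandE gE -[mkraw y es tau]/(raw_path y (zip tau.1 es) tau.2).
  case: eqP => [yx|/eqP yx]; last by rewrite raw_integrand_neq ?es2// rcoord0.
  rewrite yx in wes *; rewrite raw_integrandE ?es1 ?es2//.
  by rewrite rcoord_vector_path_value// !size_tuple.
have f_well y p : y \in well G -> rcoord (f y) p = 0.
  by move=> yW; rewrite hf// rcoord0.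
have meas p : measurable_fun setT (fun g => rcoord (integrand g) p).
  apply: (measurable_fun_cpath (F := fun y n (es : n.-tuple (edge G)) tau =>
    if y == x then path_value stay jump x es tau.1 t p else 0)) => [y n es|g y n es tau]; last first.
    exact: coordE.
  case: (y == x); last exact: measurable_cst.
  apply: (measurableT_comp (measurable_path_value_times _ _ es x t p) measurable_fst).
    by move=> z q; apply: continuous_measurable_fun; exact: continuous_stay.
  by move=> e q q'; apply: continuous_measurable_fun; exact: continuous_jump.
have main p : (walk_law x).-integrable setT (EFin \o (fun g => rcoord (integrand g) p)) /\
    (\int[walk_law x]_g rcoord (integrand g) p)%R = rcoord (heat h H t f x) p.
  rewrite rcoord_heat; apply: (real_feynman_kac f_well ht (meas p)).
  move=> n es ts wes ts0; rewrite (coordE _ _ _ _ _ _ (timed_pathK wes ts0)).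
  by rewrite eqxx.
split; first by apply: rcoord_vintegrable => p; case: (main p).
by apply: rcoord_inj => p; rewrite rcoord_vintegral; case: (main p) => _ ->.
Qed.
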